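(* Let $\varphi$ be an inclusion logic ($\mathrm{FO}(\subseteq)$) sentence. Then the parameterized problem $\text{p-}\mathrm{WT}_\varphi$ is in $\mathrm{FPT}$.
   Context: Team semantics: for a structure $\mathcal{A}$ with domain $A$, an assignment is a map $s\colon X\to A$ on a set $X$ of variables, and a team with domain $X$ is a set of such assignments. $\mathrm{FO}(\subseteq)$ extends first-order logic (in negation normal form) by inclusion atoms $\mathbf t\subseteq\mathbf u$ for tuples of terms of equal length, with $\mathcal{A},T\models\mathbf t\subseteq\mathbf u$ iff for every $s_1\in T$ there is $s_2\in T$ with $\mathbf t\langle s_1\rangle=\mathbf u\langle s_2\rangle$. First-order literals hold in $T$ iff they hold under every $s\in T$; $\wedge$ is evaluated in the same team; $\mathcal{A},T\models\varphi_0\vee\varphi_1$ iff $T=T_0\cup T_1$ with $\mathcal{A},T_i\models\varphi_i$; $\mathcal{A},T\models\exists x\varphi$ iff $\mathcal{A},\{s[x\mapsto a]:s\in T,a\in f(s)\}\models\varphi$ for some $f\colon T\to\mathcal P(A)\setminus\{\emptyset\}$; $\mathcal{A},T\models\forall x\varphi$ iff $\mathcal{A},\{s[x\mapsto a]:s\in T,a\in A\}\models\varphi$. For a fixed formula $\varphi$ with free variables $\mathrm{Fr}(\varphi)$, $\text{p-}\mathrm{WT}_\varphi$ is the parameterized problem: given a finite structure $\mathcal{A}$ and $k\in\mathbb N$ (parameter $k$), is there a team $T$ with domain $\mathrm{Fr}(\varphi)$ such that $|T|=k$ and $\mathcal{A},T\models\varphi$? For a sentence, $\mathrm{Fr}(\varphi)=\emptyset$.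 *)

(* Defs.v *)
From HB Require Import structures.
From mathcomp Require Import all_boot all_order all_algebra.
From mathcomp Require Import finmap.

Set Implicit Arguments.
Unset Strict Implicit.
Unset Printing Implicit Defensive.

Local Open Scope fset_scope.
Local Open Scope fmap_scope.

(* Finite vocabularies; constants are 0-ary function symbols. *)
Record signature := Signature {
  relS : finType;
  rel_ar : relS -> nat;
  funS : finType;
  fun_ar : funS -> nat }.

Inductive term (sg : signature) : Type :=
| Var of nat
| App (f : funS sg) of ('I_(fun_ar f) -> term sg).

(* Negation normal form: negation occurs only in the literals NRel and Neq, and
   is never applied to an inclusion atom. *)
Inductive formula (sg : signature) : Type :=
| Rel (R : relS sg) of ('I_(rel_ar R) -> term sg)
| NRel (R : relS sg) of ('I_(rel_ar R) -> term sg)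
| Eq of term sg & term sg
| Neq of term sg & term sg
| Inc (m : nat) of ('I_m -> term sg) & ('I_m -> term sg)
| And of formula sg & formula sg
| Or of formula sg & formula sg
| Ex of nat & formula sg
| All of nat & formula sg.

Fixpoint term_vars sg (t : term sg) : {fset nat} :=
  match t with
  | Var x => [fset x]
  | App f ts => \big[fsetU/fset0]_i term_vars (ts i)
  end.

Fixpoint Fr sg (phi : formula sg) : {fset nat} :=
  match phi with
  | Rel _ ts | NRel _ ts => \big[fsetU/fset0]_i term_vars (ts i)
  | Eq t u | Neq t u => term_vars t `|` term_vars u
  | Inc _ ts us => \big[fsetU/fset0]_i (term_vars (ts i) `|` term_vars (us i))
  | And p q | Or p q => Fr p `|` Fr q
  | Ex x p | All x p => Fr p `\ x
  end.

(* [dom_pt] only witnesses that the domain is nonempty. *)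
Record structure (sg : signature) := Structure {
  dom :> finType;
  dom_pt : dom;
  rel_int : forall R : relS sg, {ffun 'I_(rel_ar R) -> dom} -> bool;
  fun_int : forall f : funS sg, {ffun 'I_(fun_ar f) -> dom} -> dom }.

(* An assignment on X is a finite map with domain X; updating it at x adds x to
   its domain. *)
Definition assignment sg (A : structure sg) := {fmap nat -> A}.
Definition team sg (A : structure sg) := {fset assignment A}.

Definition team_on sg (A : structure sg) (X : {fset nat}) (T : team A) :=
  forall s : assignment A, s \in T -> domf s = X.

(* The default is irrelevant when all the variables of t lie in the domain of
   s, as is the case for every term met when evaluating phi on a team whose
   domain contains Fr phi. *)
Fixpoint eval sg (A : structure sg) (s : assignment A) (t : term sg) : A :=
  match t with
  | Var x => odflt (dom_pt A) s.[? x]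
  | App f ts => fun_int [ffun i => eval s (ts i)]
  end.

Fixpoint sat sg (A : structure sg) (T : team A) (phi : formula sg) : Prop :=
  match phi with
  | Rel R ts =>
      forall s, s \in T -> rel_int (R := R) [ffun i => eval s (ts i)]
  | NRel R ts =>
      forall s, s \in T -> ~~ rel_int (R := R) [ffun i => eval s (ts i)]
  | Eq t u => forall s, s \in T -> eval s t = eval s u
  | Neq t u => forall s, s \in T -> eval s t <> eval s u
  | Inc m ts us =>
      forall s1, s1 \in T ->
      exists2 s2, s2 \in T & forall i, eval s1 (ts i) = eval s2 (us i)
  | And p q => sat T p /\ sat T q
  | Or p q => exists T0 T1 : team A, [/\ T = T0 `|` T1, sat T0 p & sat T1 q]
  | Ex x p =>
      exists2 f : assignment A -> {set A},
        forall s, s \in T -> f s != set0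
        & sat [fset s.[x <- a] | s in T, a in f s] p
  | All x p => sat [fset s.[x <- a] | s in T, a in [set: A]] p
  end.

(* The j-th r-tuple over the domain, in the order where coordinate 0 is the
   least significant digit of j in base #|A|. *)
Definition word sg (A : structure sg) (r j : nat) : {ffun 'I_r -> A} :=
  [ffun i : 'I_r => nth (dom_pt A) (enum A) ((j %/ #|A| ^ i) %% #|A|)].

Definition table sg (A : structure sg) r (P : {ffun 'I_r -> A} -> bool) :=
  [seq P (word A r j) | j <- iota 0 (#|A| ^ r)].

(* The graph of f, with the value as last coordinate. *)
Definition fun_graph sg (A : structure sg) (f : funS sg)
    (w : {ffun 'I_(fun_ar f).+1 -> A}) : bool :=
  fun_int [ffun i => w (widen_ord (leqnSn _) i)] == w ord_max.

Definition encode sg (A : structure sg) : seq bool :=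
  nseq #|A| true ++ false ::
    flatten [seq table (@rel_int _ A R) | R <- enum (relS sg)] ++
    flatten [seq table (@fun_graph _ A f) | f <- enum (funS sg)].

(* Registers hold natural numbers and every instruction costs one step. As the
   only arithmetic is addition, truncated subtraction and halving, t steps
   lengthen numbers by O(t) bits, so that running times agree with those of
   Turing machines up to a polynomial. *)
Inductive instr : Type :=
| Const (i c : nat)
| Add (i j l : nat)
| Sub (i j l : nat)
| Half (i j : nat)
| Fetch (i j : nat)
| Store (i j : nat)
| Jump (q : nat)
| JumpZ (i q : nat).

Definition program := seq instr.
Definition memory := nat -> nat.
Definition config := (nat * memory)%type.

Definition upd (m : memory) (i v : nat) : memory :=
  fun j => if j == i then v else m j.

Definition exec (a : instr) (c : config) : config :=
  let: (pc, m) := c in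
  match a with
  | Const i v => (pc.+1, upd m i v)
  | Add i j l => (pc.+1, upd m i (m j + m l))
  | Sub i j l => (pc.+1, upd m i (m j - m l))
  | Half i j => (pc.+1, upd m i (m j)./2)
  | Fetch i j => (pc.+1, upd m i (m (m j)))
  | Store i j => (pc.+1, upd m (m i) (m j))
  | Jump q => (q, m)
  | JumpZ i q => (if m i == 0 then q else pc.+1, m)
  end.

(* A machine halts when its program counter leaves the program; the halted
   configuration is then kept forever. *)
Definition step (M : program) (c : config) : config :=
  if onth M c.1 is Some a then exec a c else c.

Definition halts_within (M : program) (m : memory) (t out : nat) : Prop :=
  let: c := iter t (step M) (0, m) in size M <= c.1 /\ c.2 0 = out.

(* r_0 = k, r_1 = |x|, then the bits of x; all other registers are 0. *)
Definition input (x : seq bool) (k : nat) : memory :=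
  fun i => match i with
           | 0 => k
           | 1 => size x
           | j.+2 => nth false x j : nat
           end.

Definition computable (f : nat -> nat) : Prop :=
  exists M : program, forall k, exists t, halts_within M (input [::] k) t (f k).

(* A parameterized problem is a subset of {0,1}^* x N, the second component
   being the parameter. *)
Definition param_problem := seq bool -> nat -> Prop.

Definition FPT (Q : param_problem) : Prop :=
  exists (M : program) (f : nat -> nat) (p : {poly nat}),
    computable f /\
    forall x k, exists2 out,
      halts_within M (input x k) (f k * p.[size x]%R) out & (0 < out <-> Q x k).

(* Strings that do not encode a structure are no-instances. *)
Definition p_WT sg (phi : formula sg) : param_problem := fun x k =>
  exists2 A : structure sg, x = encode A
    & exists T : team A, [/\ team_on (Fr phi) T, #|` T| = k & sat T phi].

(* Main.v *)
(* Attach to every subformula a team of total assignments of the variables below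
   some fixed m. The clauses of team semantics become local constraints between
   the team of a subformula and the teams of its children, and every constraint
   has the form "s belongs to a team only if some other memberships hold"; hence
   there is a greatest family of teams obeying them, reached from the full teams
   by deleting offending assignments. A sentence holds in the team consisting of
   the empty assignment iff the team of the root in the greatest family is
   nonempty. As there are polynomially many pairs of a subformula and an
   assignment, the deletions take polynomial time. A team over the empty domain
   has at most one member, so k = 0 asks only whether the input encodes a
   structure, and k >= 2 is always rejected. *)

Require Import Defs.
From mathcomp Require Import all_boot all_algebra finmap zify.

Set Implicit Arguments.
Unset Strict Implicit.
Unset Printing Implicit Defensive.

(** * Structured programs *)

(** The constraints must run in both directions, from a subformula to its children and back.
    Inclusion atoms are preserved neither in subteams nor in superteams, so a child may carry no
    assignment that its parent does not account for: a split has to cover exactly the team, and a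
    quantifier produces exactly the supplemented team.

    Total assignments are numbers read in base [#|A|], one digit per variable, whereas the semantics
    uses finite maps whose domain grows at each quantifier. The two meet through restriction of
    codes to a domain, which is not injective; teams are therefore images of sets of codes.

    On the machine side the input fills the registers from 2 on, so no work space of known address
    is free, and the first bits have to be moved before anything else runs. Time analysis is done
    once, for a class of functions closed under arithmetic and bounded sums; the evaluation of
    formulas is then written inside this class. The parameter costs nothing: [k >= 2] is dismissed
    after a constant number of steps, so the factor depending on [k] is 1. *)

Inductive cmd :=
| Block of seq instr
| Seq of cmd & cmd
| While of nat & cmd.

Fixpoint csize (c : cmd) : nat :=
  match c with
  | Block l => size l
  | Seq c1 c2 => csize c1 + csize c2
  | While _ c1 => (csize c1).+2
  end.

Fixpoint compile (c : cmd) (pc : nat) : program :=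
  match c with
  | Block l => l
  | Seq c1 c2 => compile c1 pc ++ compile c2 (pc + csize c1)
  | While r c1 =>
      JumpZ r (pc + (csize c1).+2) :: compile c1 pc.+1 ++ [:: Jump pc]
  end.

Definition straight (a : instr) : bool :=
  match a with Jump _ | JumpZ _ _ => false | _ => true end.

Definition effect (m : memory) (a : instr) : memory := (exec a (0, m)).2.

Inductive run : cmd -> memory -> memory -> nat -> Prop :=
| RunBlock l m : all straight l -> run (Block l) m (foldl effect m l) (size l)
| RunSeq c1 c2 m m1 m2 t1 t2 :
    run c1 m m1 t1 -> run c2 m1 m2 t2 -> run (Seq c1 c2) m m2 (t1 + t2)
| RunStop r c m : m r = 0 -> run (While r c) m m 1
| RunIter r c m m1 m2 t1 t2 :
    0 < m r -> run c m m1 t1 -> run (While r c) m1 m2 t2 ->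
    run (While r c) m m2 (t1 + t2).+2.

Lemma size_compile c pc : size (compile c pc) = csize c.
Proof.
elim: c pc => [//|c1 IH1 c2 IH2|r c IH] pc /=; first by rewrite size_cat IH1 IH2.
by rewrite size_cat IH /=; lia.
Qed.

Lemma step_at l a r m : step (l ++ a :: r) (size l, m) = exec a (size l, m).
Proof. by rewrite /step onth_cat /= ltnn subnn. Qed.

(** Jump targets are absolute, so the code is placed between an arbitrary prefix [l], whose length
    fixes the targets, and an arbitrary suffix [r]; this lets the induction reach subcommands in
    place. *)
Lemma compile_run c m m' t : run c m m' t -> forall l r,
  iter t (step (l ++ compile c (size l) ++ r)) (size l, m)
  = (size l + csize c, m').
Proof.
elim=> {c m m' t} /=
  [s m ss|c1 c2 m m1 m2 t1 t2 _ IH1 _ IH2|r c m m0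
  |r c m m1 m2 t1 t2 mr _ IH1 _ IH2] l r'.
- elim: s m l ss => [|a s IHs] m l /=; first by rewrite addn0.
  case/andP=> sa ss; rewrite -iterS iterSr step_at.
  have ->: exec a (size l, m) = (size (rcons l a), effect m a).
    by rewrite size_rcons; case: a sa.
  have := IHs (effect m a) (rcons l a) ss; rewrite cat_rcons => ->.
  by rewrite size_rcons addSnnS.
- rewrite addnC iterD -catA IH1 catA.
  have := IH2 (l ++ compile c1 (size l)) r'.
  by rewrite !size_cat size_compile => ->; rewrite addnA.
- by rewrite step_at /= m0.
- rewrite -iterS iterSr step_at /= gtn_eqF //.
  rewrite -iterS -addnS addnC iterD.
  have := IH1 (rcons l (JumpZ r (size l + (csize c).+2))) (Jump (size l) :: r').
  rewrite size_rcons cat_rcons -catA /= => ->; rewrite -iterS iterSr.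
  have := step_at (rcons l (JumpZ r (size l + (csize c).+2))
    ++ compile c (size l).+1) (Jump (size l)) r' m1.
  rewrite size_cat size_rcons size_compile -catA cat_rcons => ->.
  by have := IH2 l r'; rewrite /= -catA.
Qed.

(** * Polynomial-time functions of a loop context *)

Record inp := Inp { flag : bool; bits : seq bool; cells : nat -> bool }.

Fixpoint Ctx (d : nat) : Type :=
  if d is d'.+1 then (Ctx d' * nat)%type else inp.

Fixpoint base d : Ctx d -> inp :=
  match d with 0 => id | d'.+1 => fun t => base t.1 end.

(** The loop variables count towards the size, so the cost of a loop body may depend polynomially on
    them. *)
Fixpoint nrm d : Ctx d -> nat :=
  match d with 0 => fun t => size (bits t) | d'.+1 => fun t => nrm t.1 + t.2 end.

(* The first K bits of the input, which the work registers overwrite, are kept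
   at the address m 2 on, followed by the cells; the other bits stay in place. *)
Record rep (K : nat) (t : inp) (m : memory) : Prop := Rep {
  rep_flag : m 0 = flag t;
  rep_size : m 1 = size (bits t);
  rep_const : m 3 = K;
  rep_gap : K + size (bits t) + 2 < m 2;
  rep_low : forall j, j < K -> m (m 2 + j) = nth false (bits t) j;
  rep_high : forall j, K <= j <= size (bits t) ->
    m (j + 2) = nth false (bits t) j;
  rep_cells : forall a, m (m 2 + K + a) = cells t a }.

Fixpoint agree K d : Ctx d -> seq nat -> memory -> Prop :=
  match d with
  | 0 => fun t rs m => rep K t m
  | d'.+1 => fun t rs m => m (head 0 rs) = t.2 /\ agree K t.1 (behead rs) m
  end.

Definition same_but (b K : nat) (m m' : memory) : Prop :=
  forall i, (i < b) || (K <= i) -> m' i = m i.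

(* rs lists the registers of the loop variables, innermost first; the code leaves
   its result in b and writes only to the registers from b to K - 1. *)
Definition polytime d (F : Ctx d -> nat) : Prop := exists D e,
  (forall t, F t <= (nrm t).+2 ^ e) /\
  forall K rs b, 4 <= b -> b + D <= K -> all (fun r => r < b) rs ->
  exists c, forall t m, agree K t rs m -> exists m' T,
    [/\ run c m m' T, m' b = F t, same_but b K m m' & T <= (nrm t).+2 ^ e].

Lemma same_but_trans b K m1 m2 m3 :
  same_but b K m1 m2 -> same_but b K m2 m3 -> same_but b K m1 m3.
Proof. by move=> h1 h2 i hi; rewrite h2 // h1. Qed.

Lemma same_butW b b' K m m' : b <= b' -> same_but b' K m m' -> same_but b K m m'.
Proof. by move=> le_b h i hi; apply: h; lia. Qed.

Lemma rep_same K t m m' b : 4 <= b -> same_but b K m m' -> rep K t m -> rep K t m'.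
Proof.
move=> b4 h [h0 h1 h3 hg hl hh hc].
split; rewrite ?(h 0) ?(h 1) ?(h 2) ?(h 3) //; try lia.
- by move=> j hj; rewrite h ?hl //; lia.
- by move=> j hj; rewrite h ?hh //; lia.
- by move=> a; rewrite h ?hc //; lia.
Qed.

Lemma agree_same K d (t : Ctx d) rs m m' b :
  4 <= b -> all (fun r => r < b) rs -> same_but b K m m' ->
  agree K t rs m -> agree K t rs m'.
Proof.
move=> b4 + h; elim: d t rs => [|d IH] t rs hrs /=; first exact: rep_same h.
case=> <- /IH hag; split.
  by apply: h; case: rs hrs {hag} => [|r rs] /=; lia.
by apply: hag; case: rs hrs => //= r rs /andP[].
Qed.

Lemma agree_rep K d (t : Ctx d) rs m : agree K t rs m -> rep K (base t) m.
Proof. by elim: d t rs => [|d IH] t rs //= [_ /IH]. Qed.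

(** All bounds are powers of [(nrm t).+2]. As this base is at least 2 even on the empty input, sums
    and constants are absorbed by raising the exponent, and no coefficients have to be tracked. *)
Lemma leq_add_expn B a b e1 e2 : 2 <= B -> a <= B ^ e1 -> b <= B ^ e2 ->
  a + b <= B ^ (e1 + e2).+1.
Proof.
move=> B2 ha hb; have h1 : a <= B ^ (e1 + e2).
  by apply: leq_trans ha _; rewrite leq_exp2l // leq_addr.
have h2 : b <= B ^ (e1 + e2).
  by apply: leq_trans hb _; rewrite leq_exp2l // leq_addl.
by rewrite expnS; nia.
Qed.

Lemma leq_mul_expn B a b e1 e2 : a <= B ^ e1 -> b <= B ^ e2 ->
  a * b <= B ^ (e1 + e2).
Proof. by move=> ha hb; rewrite expnD leq_mul. Qed.

Lemma leq_const_expn B c : 2 <= B -> c <= B ^ c.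
Proof.
case: c => // c B2; apply: (@leq_trans (2 ^ c.+1)); last by rewrite leq_exp2r.
exact: ltnW (ltn_expl c.+1 (isT : 1 < 2)).
Qed.

Lemma leq_expn_le B a e e' : 2 <= B -> a <= B ^ e -> e <= e' -> a <= B ^ e'.
Proof. by move=> B2 ha he; apply: leq_trans ha _; rewrite leq_exp2l. Qed.

(** * Closure properties of polynomial-time functions *)

Lemma polytime_ext d (F G : Ctx d -> nat) : F =1 G -> polytime F -> polytime G.
Proof.
move=> FG [D [e [hb hF]]]; exists D, e; split=> [t|K rs b h1 h2 h3].
  by rewrite -FG.
have [c hc] := hF K rs b h1 h2 h3; exists c => t m /hc[m' [T []]].
by rewrite FG; exists m', T.
Qed.

Ltac mem := rewrite /= /effect /= /upd /=; repeat (case: eqP => ?); try lia.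

Lemma polytime_block d (F : Ctx d -> nat) (D e : nat)
    (code : nat -> seq nat -> seq instr) :
  (forall t, F t <= (nrm t).+2 ^ e) ->
  (forall K rs b t m, 4 <= b -> b + D <= K -> all (fun r => r < b) rs ->
     agree K t rs m ->
     [/\ all straight (code b rs), size (code b rs) <= e,
       foldl effect m (code b rs) b = F t &
       same_but b K m (foldl effect m (code b rs))]) ->
  polytime F.
Proof.
move=> hF hcode; exists D, e; split=> // K rs b h1 h2 h3.
exists (Block (code b rs)) => t m /(hcode K rs b t m h1 h2 h3)[hs hsz hv hsame].
exists (foldl effect m (code b rs)), (size (code b rs)); split=> //.
  exact: RunBlock.
by apply: leq_trans hsz _; apply: leq_const_expn.
Qed.

Lemma polytime_const {d} c : polytime (fun _ : Ctx d => c).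
Proof.
apply: (@polytime_block _ _ 1 c.+1 (fun b _ => [:: Const b c])).
  by move=> t; apply: leq_expn_le (leq_const_expn c _) _.
by move=> K rs b t m *; split=> // [|i hi]; mem.
Qed.

Lemma polytime_size d : polytime (fun t : Ctx d => size (bits (base t))).
Proof.
apply: (@polytime_block _ _ 1 2 (fun b _ => [:: Const b 0; Add b b 1])).
  move=> t; apply: (@leq_trans (nrm t)); last by rewrite expnS expn1; nia.
  by elim: d t => [|d IH] t //=; apply: leq_trans (IH _) (leq_addr _ _).
by move=> K rs b t m b4 ? ? /agree_rep/rep_size h; split=> // [|i hi]; mem.
Qed.

Lemma polytime_flag d : polytime (fun t : Ctx d => flag (base t)).
Proof.
apply: (@polytime_block _ _ 1 2 (fun b _ => [:: Const b 0; Add b b 0])).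
  by move=> t; case: (flag _); rewrite ?expn_gt0.
by move=> K rs b t m b4 ? ? /agree_rep/rep_flag h; split=> // [|i hi]; mem.
Qed.

Lemma polytime_last d : polytime (fun t : Ctx d.+1 => t.2).
Proof.
apply: (@polytime_block _ _ 1 2 (fun b rs => [:: Const b 0; Add b b (head 0 rs)])).
  by case=> t i /=; rewrite expnS expn1; nia.
move=> K rs b [t i] m b4 ? hrs [/= hm _].
have hb : head 0 rs < b by case: (rs) hrs => [|r l] /=; lia.
by split=> // [|j hj]; mem.
Qed.

Lemma polytime_prev d (F : Ctx d -> nat) :
  polytime F -> polytime (fun t : Ctx d.+1 => F t.1).
Proof.
case=> D [e [hb hF]]; exists D, e.
have le_nrm (t : Ctx d.+1) : (nrm t.1).+2 ^ e <= (nrm t).+2 ^ e.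
  by case: e {hb hF} => // e; rewrite leq_exp2r //= !ltnS leq_addr.
split=> [t|K rs b h1 h2 h3]; first exact: leq_trans (hb _) (le_nrm t).
have [|c hc] := hF K (behead rs) b h1 h2; first by case: (rs) h3 => //= ? ? /andP[].
exists c => t m [_ /hc[m' [T [r v s le_T]]]].
by exists m', T; split=> //; apply: leq_trans le_T (le_nrm t).
Qed.

(** Postcomposition with constant-time code that turns the value in [b] into the new one. It is a
    command and not a block because [polytime_bit] has to branch. *)
Lemma polytime_then d (F G : Ctx d -> nat) (D e : nat) (code : nat -> cmd) :
  (forall t, G t <= (nrm t).+2 ^ e) ->
  (forall K rs b t m, 4 <= b -> b + D <= K -> agree K t rs m -> m b = F t ->
     exists m' T, [/\ run (code b) m m' T, T <= e, m' b = G t &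
       same_but b K m m']) ->
  polytime F -> polytime G.
Proof.
move=> hG hcode [D' [e' [hF hc]]]; exists (D + D'), (e + e').+1.
split=> [t|K rs b h1 h2 h3].
  by apply: leq_expn_le (hG t) _; lia.
have [|c {}hc] := hc K rs b h1 _ h3; first lia.
exists (Seq c (code b)) => t m hm.
have [m1 [T1 [r1 v1 s1 le1]]] := hc t m hm.
have [||m2 [T2 [r2 le2 v2 s2]]] := hcode K rs b t m1 h1 _ _ v1; first lia.
  exact: agree_same h1 h3 s1 hm.
exists m2, (T1 + T2); split=> //; first exact: RunSeq r1 r2.
  exact: same_but_trans s1 s2.
rewrite addnC; apply: leq_add_expn => //.
by apply: leq_trans le2 _; apply: leq_const_expn.
Qed.

Lemma polytime_op2 d (op : nat -> nat -> nat) (i : nat -> nat -> nat -> instr)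
    (F1 F2 : Ctx d -> nat) :
  (forall x y, op x y <= x + y) ->
  (forall a b l, straight (i a b l)) ->
  (forall a b l m, effect m (i a b l) = upd m a (op (m b) (m l))) ->
  polytime F1 -> polytime F2 -> polytime (fun t => op (F1 t) (F2 t)).
Proof.
move=> hop hs he [D1 [e1 [b1 h1]]] [D2 [e2 [b2 h2]]].
exists (D1 + D2).+1, (e1 + e2).+2.
have le_e (t : Ctx d) : (nrm t).+2 ^ (e1 + e2).+1 <= (nrm t).+2 ^ (e1 + e2).+2
  by rewrite leq_exp2l.
split=> [t|K rs b hb hK hrs].
  apply: leq_trans (hop _ _) _; apply: leq_trans _ (le_e t).
  exact: leq_add_expn.
have [|c1 {}h1] := h1 K rs b hb _ hrs; first lia.
(* The second operand is computed from register [b.+1] on, which leaves the first one in [b]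
   untouched. *)
have [|||c2 {}h2] := h2 K rs b.+1; [lia|lia|by apply: sub_all hrs => r; lia|].
exists (Seq (Seq c1 c2) (Block [:: i b b b.+1])) => t m hm.
have [m1 [T1 [r1 v1 s1 le1]]] := h1 t m hm.
have [m2 [T2 [r2 v2 s2 le2]]] := h2 t m1 (agree_same hb hrs s1 hm).
exists (foldl effect m2 [:: i b b b.+1]), (T1 + T2 + 1); split.
- by apply: RunSeq (RunSeq r1 r2) (RunBlock _ _); rewrite /= hs.
- by rewrite /= he /upd eqxx v2 s2 ?v1 // ltnSn.
- move=> j hj; rewrite /= he /upd; case: eqP => [?|_]; first lia.
  by rewrite s2 ?s1 //; lia.
- have := leq_add_expn (isT : 1 < (nrm t).+2) le1 le2; rewrite (expnS _ (_.+1)).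
  have : 0 < (nrm t).+2 ^ (e1 + e2).+1 by rewrite expn_gt0.
  by move: (_ ^ _.+1) => X; nia.
Qed.

Lemma polytime_add d (F1 F2 : Ctx d -> nat) :
  polytime F1 -> polytime F2 -> polytime (fun t => F1 t + F2 t).
Proof. exact: (@polytime_op2 d addn Add). Qed.

Lemma polytime_sub d (F1 F2 : Ctx d -> nat) :
  polytime F1 -> polytime F2 -> polytime (fun t => F1 t - F2 t).
Proof.
have le_sub x y : x - y <= x + y by lia.
exact: (@polytime_op2 d subn Defs.Sub F1 F2 le_sub).
Qed.

Lemma polytime_cell d (F : Ctx d -> nat) :
  polytime F -> polytime (fun t => cells (base t) (F t)).
Proof.
pose code b := [:: Add b b 2; Add b b 3; Fetch b b].
apply: (polytime_then (D := 1) (e := 3) (code := fun b => Block (code b))).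
  by move=> t; case: (cells _ _); rewrite ?expn_gt0.
move=> K rs b t m hb hK /agree_rep[_ _ h3 hg _ _ hc] hF.
exists (foldl effect m (code b)), 3; split=> //; first exact: RunBlock.
  by rewrite -hc -hF; mem; congr (m _); lia.
by move=> i hi; mem.
Qed.

(** Bit [j] lives at [m 2 + j] if [j < K] and at [j + 2] otherwise. Commands have no conditional, so
    a loop on [K - j] that clears its own counter plays the role of one. The index is first cut down
    to the length of the input, where the representation still guarantees a zero, the default of
    [nth]. *)
Lemma polytime_bit d (F : Ctx d -> nat) :
  polytime F -> polytime (fun t => nth false (bits (base t)) (F t)).
Proof.
pose pre b := [:: Defs.Sub b.+1 b 1; Defs.Sub b b b.+1; Defs.Sub b.+1 3 b;
  Const b.+2 2; Add b b b.+2].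
pose mid b := [:: Add b b 2; Const b.+2 2; Defs.Sub b b b.+2; Const b.+1 0].
apply: (polytime_then (D := 3) (e := 20)
  (code := fun b => Seq (Seq (Block (pre b)) (While b.+1 (Block (mid b))))
    (Block [:: Fetch b b]))).
  by move=> t; case: (nth _ _ _); rewrite ?expn_gt0.
move=> K rs b t m hb hK /agree_rep[_ h1 h3 hg hl hh _] hF.
set s := size _ in h1 hg hh; set j := minn (F t) s.
set m1 := foldl effect m (pre b).
have e1 : [/\ m1 b = j + 2, m1 b.+1 = K - j, m1 2 = m 2 & same_but b K m m1].
  by rewrite /m1 /j; split=> [|||i hi]; mem.
case: e1 => v1 w1 p1 s1.
have nth_j : nth false (bits (base t)) (F t) = nth false (bits (base t)) j.
  by rewrite /j; case: (leqP (F t) s) => // lt_s; rewrite !nth_default // ltnW.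
have [lt_jK|le_Kj] := ltnP j K.
- set m2 := foldl effect m1 (mid b).
  have e2 : [/\ m2 b = m 2 + j, m2 b.+1 = 0 & same_but b K m1 m2].
    by rewrite /m2; split=> [||i hi]; mem.
  case: e2 => v2 w2 s2.
  exists (effect m2 (Fetch b b)), (5 + (4 + 1).+2 + 1); split=> //.
  + apply: RunSeq (RunSeq (RunBlock (l := pre b) _ _) _) (RunBlock (l := [::
      _]) _ _) => //.
    apply: RunIter (RunBlock (l := mid b) _ _) (RunStop _ _) => //.
    by rewrite -/m1; lia.
  + rewrite nth_j -hl //; mem; rewrite v2 s2 ?s1 //; lia.
  + by move=> i hi; mem; rewrite s2 ?s1.
- exists (effect m1 (Fetch b b)), (5 + 1 + 1); split=> //.
  + apply: RunSeq (RunSeq (RunBlock (l := pre b) _ _) _) (RunBlock (l := [::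
      _]) _ _) => //.
    by apply: RunStop; rewrite -/m1; lia.
  + rewrite nth_j -hh; last by rewrite le_Kj geq_minr.
    by mem; rewrite v1 s1 //; lia.
  + by move=> i hi; mem; rewrite s1.
Qed.

(** The one looping construct for functions: products, bounded quantifiers and quotients are all
    derived from it. Register [b] counts down, [b.+1] accumulates, [b.+2] is the loop variable and
    [b.+3] receives the value of the body. *)
Lemma polytime_sum d (F : Ctx d -> nat) (G : Ctx d -> nat -> nat) :
  polytime F -> polytime (fun t : Ctx d.+1 => G t.1 t.2) ->
  polytime (fun t => \sum_(i < F t) G t i).
Proof.
move=> [D1 [e1 [b1 h1]]] [D2 [e2 [b2 h2]]].
(* With base [B = (nrm t).+2], an index below [F t <= B ^ e1] gives the body a size of at most
   [B ^ (e1 + 2)], to be raised to its exponent [e2]. *)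
set e := (e1 + 2) * e2.
have le_body (t : Ctx d) i : i < F t -> (nrm t + i).+2 ^ e2 <= (nrm t).+2 ^ e.
  move=> lt_i; rewrite /e expnM; case: (e2) => // k; rewrite leq_exp2r //.
  have := b1 t; rewrite expnD (_ : _ ^ 2 = (nrm t).+2 * (nrm t).+2) //.
  have : 0 < (nrm t).+2 ^ e1 by rewrite expn_gt0.
  by move: (_ ^ e1) => X; nia.
exists (D1 + D2 + 4), (e1 + e1 + e + 9); split=> [t|K rs b hb hK hrs].
  have : \sum_(i < F t) G t i <= \sum_(i < F t) (nrm t).+2 ^ e.
    apply: leq_sum => i _; apply: leq_trans (le_body t i (ltn_ord i)).
    exact: b2 (t, i : nat).
  rewrite sum_nat_const card_ord => /leq_trans; apply.
  by apply: leq_expn_le (leq_mul_expn (b1 t) (leqnn _)) _; lia.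
have [|c1 {}h1] := h1 K rs b hb _ hrs; first lia.
have [|||c2 {}h2] := h2 K (b.+2 :: rs) b.+3; [lia|lia| |].
  by apply/andP; split; [lia | apply: sub_all hrs => r; lia].
pose pre := [:: Const b.+1 0; Const b.+2 0].
pose post := [:: Add b.+1 b.+1 b.+3; Const b.+3 1; Add b.+2 b.+2 b.+3;
  Defs.Sub b b b.+3].
pose fin := [:: Const b 0; Add b b.+1 b].
exists (Seq (Seq (Seq c1 (Block pre)) (While b (Seq c2 (Block post)))) (Block
  fin)) => t m hm.
have [m1 [T1 [r1 v1 s1 le1]]] := h1 t m hm.
(* Loop invariant with [r] rounds left and [i] rounds done. *)
have loop r i m2 : r + i = F t -> m2 b = r ->
    m2 b.+1 = \sum_(l < i) G t l -> m2 b.+2 = i -> same_but b K m m2 ->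
    exists m3 T, [/\ run (While b (Seq c2 (Block post))) m2 m3 T,
      m3 b.+1 = \sum_(l < F t) G t l, same_but b K m m3 &
      T <= r * ((nrm t).+2 ^ e + 6) + 1].
  elim: r i m2 => [|r IH] i m2 hr vb vs vi sm.
    by exists m2, 1; split=> //; [apply: RunStop|rewrite -hr].
  have [|m3 [T3 [r3 v3 s3 le3]]] := h2 (t, i) m2.
    by split=> //=; apply: agree_same hb hrs sm hm.
  rewrite /= in v3 le3; set m4 := foldl effect m3 post.
  have sb l : l < b.+3 -> m3 l = m2 l by move=> hl; rewrite s3 // hl.
  have [||||| m5 [T5 [r5 v5 s5 le5]]] := IH i.+1 m4.
  - lia.
  - by rewrite /m4; mem; rewrite sb; lia.
  - by rewrite big_ord_recr /= -v3 -vs -(sb b.+1) // /m4; mem.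
  - by rewrite /m4; mem; rewrite sb; lia.
  - apply: same_but_trans sm (same_but_trans (same_butW _ s3) _); first lia.
    by move=> l hl; rewrite /m4; mem.
  exists m5, (T3 + 4 + T5).+2; split=> //.
    apply: RunIter r5; first by rewrite vb.
    exact: RunSeq r3 (RunBlock (l := post) _ _).
  have := le_body t i; have : i < F t by lia.
  by move=> lt_i /(_ lt_i); move: le3; lia.
set m2 := foldl effect m1 pre.
have [|||||m3 [T3 [r3 v3 s3 le3]]] := loop (F t) 0 m2.
- lia.
- by rewrite /m2; mem.
- by rewrite big_ord0 /m2; mem.
- by rewrite /m2; mem.
- by apply: same_but_trans s1 _ => l hl; rewrite /m2; mem.
exists (foldl effect m3 fin), (T1 + 2 + T3 + 2); split.
- apply: RunSeq (RunSeq (RunSeq r1 (RunBlock (l := pre) _ _)) r3) _ => //.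
  exact: (RunBlock (l := fin)).
- by rewrite -v3; mem.
- by apply: same_but_trans s3 _ => l hl; mem.
- rewrite (_ : e1 + e1 + e + 9 = e1 + (e1 + e + 9)); last lia.
  rewrite expnD.
  have hX := b1 t; have : T1 + 2 + T3 + 2 <= (nrm t).+2 ^ e1 * ((nrm t).+2 ^ e
    + 12).
    have : 0 < (nrm t).+2 ^ e1 by rewrite expn_gt0.
    by nia.
  move=> /leq_trans; apply; rewrite leq_mul // 2!expnD.
  have : 0 < (nrm t).+2 ^ e1 by rewrite expn_gt0.
  have : 0 < (nrm t).+2 ^ e by rewrite expn_gt0.
  have : 13 <= (nrm t).+2 ^ 9 by apply: (@leq_trans (2 ^ 9)); rewrite ?leq_exp2r.
  move: ((nrm t).+2 ^ e1) ((nrm t).+2 ^ e) ((nrm t).+2 ^ 9) => X Y Z hZ hY hX'.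
  by apply: (@leq_trans (Y * Z)); [nia | rewrite -mulnA leq_pmull].
Qed.

Lemma polytime_mul d (F1 F2 : Ctx d -> nat) :
  polytime F1 -> polytime F2 -> polytime (fun t => F1 t * F2 t).
Proof.
move=> h1 h2; apply: (@polytime_ext _ (fun t => \sum_(i < F1 t) F2 t)).
  by move=> t; rewrite sum_nat_const card_ord.
exact: (polytime_sum (G := fun t _ => F2 t) h1 (polytime_prev h2)).
Qed.

Lemma polytime_exp d (F : Ctx d -> nat) k :
  polytime F -> polytime (fun t => F t ^ k).
Proof.
move=> hF; elim: k => [|k IH]; first exact: polytime_const.
apply: (@polytime_ext _ (fun t => F t * F t ^ k)); last exact: polytime_mul.
by move=> t; rewrite expnS.
Qed.

Lemma polytime_bigsum d (I : Type) (r : seq I) (F : I -> Ctx d -> nat) :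
  (forall i, polytime (F i)) -> polytime (fun t => \sum_(i <- r) F i t).
Proof.
move=> hF; elim: r => [|i r IH].
  by apply: polytime_ext (polytime_const 0) => t; rewrite big_nil.
by apply: polytime_ext (polytime_add (hF i) IH) => t; rewrite big_cons.
Qed.

Lemma polytime_leq d (F1 F2 : Ctx d -> nat) :
  polytime F1 -> polytime F2 -> polytime (fun t => F1 t <= F2 t).
Proof.
move=> h1 h2; have h := polytime_sub (polytime_const 1) (polytime_sub h1 h2).
by apply: polytime_ext h => t; lia.
Qed.

Lemma polytime_neg d (P : Ctx d -> bool) :
  polytime (fun t => P t) -> polytime (fun t => ~~ P t).
Proof.
move=> h; apply: polytime_ext (polytime_sub (polytime_const 1) h) => t.
by case: (P t).
Qed.

Lemma polytime_and d (P Q : Ctx d -> bool) : polytime (fun t => P t) ->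
  polytime (fun t => Q t) -> polytime (fun t => P t && Q t).
Proof.
by move=> h1 h2; apply: polytime_ext (polytime_mul h1 h2) => t; rewrite mulnb.
Qed.

Lemma polytime_or d (P Q : Ctx d -> bool) : polytime (fun t => P t) ->
  polytime (fun t => Q t) -> polytime (fun t => P t || Q t).
Proof.
move=> /polytime_neg h1 /polytime_neg h2.
apply: polytime_ext (polytime_neg (polytime_and h1 h2)) => t.
by rewrite negb_and !negbK.
Qed.

Lemma polytime_eq d (F1 F2 : Ctx d -> nat) :
  polytime F1 -> polytime F2 -> polytime (fun t => F1 t == F2 t).
Proof.
move=> h1 h2.
apply: polytime_ext (polytime_and (polytime_leq h1 h2) (polytime_leq h2 h1)) => t.
by rewrite eqn_leq.
Qed.

Lemma polytime_has d (F : Ctx d -> nat) (P : Ctx d -> pred nat) :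
  polytime F -> polytime (fun t : Ctx d.+1 => P t.1 t.2) ->
  polytime (fun t => has (P t) (iota 0 (F t))).
Proof.
move=> hF hP; have hs := polytime_sum (G := fun t i => P t i) hF hP.
apply: polytime_ext (polytime_leq (polytime_const 1) hs) => t.
rewrite has_count -sum1_count -(big_mkord xpredT (fun i => nat_of_bool (P t i))).
rewrite /index_iota subn0; congr (nat_of_bool (_ <= _)).
by rewrite [RHS]big_mkcond; apply: eq_bigr => i _; case: (P t i).
Qed.

Lemma polytime_all d (F : Ctx d -> nat) (P : Ctx d -> pred nat) :
  polytime F -> polytime (fun t : Ctx d.+1 => P t.1 t.2) ->
  polytime (fun t => all (P t) (iota 0 (F t))).
Proof.
move=> hF /polytime_neg hP.
have := polytime_neg (@polytime_has _ _ (fun t i => ~~ P t i) hF hP).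
by apply: polytime_ext => t; rewrite -[~~ has _ _]/(~~ has (predC _) _)
  has_predC negbK.
Qed.

Lemma polytime_all_seq d (I : Type) (r : seq I) (P : I -> Ctx d -> bool) :
  (forall i, polytime (fun t => P i t)) ->
  polytime (fun t => all (fun i => P i t) r).
Proof.
move=> hP; elim: r => [|i r IH]; first exact: (polytime_const 1).
exact: polytime_and (hP i) IH.
Qed.

(** The quotient counts the [i < F1 t] with [i.+1 * F2 t <= F1 t]. The factor [1 <= F2 t] restores
    the convention that division by 0 gives 0, where this count would be [F1 t]. *)
Lemma polytime_div d (F1 F2 : Ctx d -> nat) :
  polytime F1 -> polytime F2 -> polytime (fun t => F1 t %/ F2 t).
Proof.
move=> h1 h2.
have hb : polytime (fun t : Ctx d.+1 => t.2.+1 * F2 t.1 <= F1 t.1).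
  apply: polytime_leq (polytime_prev h1); apply: polytime_mul (polytime_prev h2).
  by apply: polytime_ext (polytime_add (polytime_const 1) (polytime_last d)) => t.
have hs := polytime_sum (G := fun t i => i.+1 * F2 t <= F1 t) h1 hb.
apply: polytime_ext (polytime_mul (polytime_leq (polytime_const 1) h2) hs) => t /=.
case: (posnP (F2 t)) => [-> //|F2_gt0]; rewrite mul1n.
under eq_bigr do rewrite -leq_divRL //.
rewrite -(big_mkord xpredT (fun i => nat_of_bool (i < F1 t %/ F2 t))).
have le_div := leq_div (F1 t) (F2 t).
rewrite (big_cat_nat (leq0n _) le_div) /=.
rewrite (eq_big_nat _ _ (F2 := fun=> 1)); last by move=> i /andP[_ ->].
rewrite [X in _ + X](eq_big_nat _ _ (F2 := fun=> 0)); last first.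
  by move=> i /andP[]; rewrite leqNgt => /negbTE->.
by rewrite !sum_nat_const_nat muln0 addn0 muln1 subn0.
Qed.

Lemma polytime_mod d (F1 F2 : Ctx d -> nat) :
  polytime F1 -> polytime F2 -> polytime (fun t => F1 t %% F2 t).
Proof.
move=> h1 h2.
apply: polytime_ext (polytime_sub h1 (polytime_mul (polytime_div h1 h2) h2)) => t.
by rewrite {1}(divn_eq (F1 t) (F2 t)) addKn.
Qed.

(** * Repeated passes over the cells *)

Definition set_cells (t : inp) (c : nat -> bool) : inp := Inp (flag t) (bits t) c.

(** The update is done in place, from cell [k - 1] down to cell 0, so later updates of a pass see
    the earlier ones and no second copy of the cells is needed. A mark once set is never removed. *)
Fixpoint pass (V : (nat -> bool) -> nat -> bool) (k : nat) (c : nat -> bool) :=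
  if k is j.+1 then pass V j (fun a => if a == j then c j || V c j else c a)
  else c.

(** Two nested countdown loops: register 4 counts passes, 5 is both inner counter and cell index, 6
    receives the new mark and 7 the address. The inner bound is recomputed at every pass; since [T]
    ignores the cells, its value does not change. *)
Lemma pass_run (T : inp -> nat) (V : inp -> nat -> bool) :
  (forall t c, T (set_cells t c) = T t) ->
  polytime (T : Ctx 0 -> nat) -> polytime (fun t : Ctx 1 => V t.1 t.2) ->
  exists D e, forall K, D <= K -> exists c, forall t m, rep K t m ->
  exists m' tm, [/\ run c m m' tm, tm <= (size (bits t)).+2 ^ e &
    rep K (set_cells t (iter (T t) (pass (fun c =>
      V (set_cells t c)) (T t)) (cells t))) m'].
Proof.
move=> T_cells [D1 [e1 [b1 h1]]] hV.
(* The old mark is part of the computed value, so one unconditional store performs the update. *)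
have : polytime (fun t : Ctx 1 => cells (base t) t.2 || V t.1 t.2).
  by apply: polytime_or => //; apply/polytime_cell/polytime_last.
(* One update sees a cell index below [B ^ e1] and costs at most [B ^ ((e1 + 1) * e2)]; the
   [T t * T t] updates contribute [e1 + e1], and [2 ^ 5] swallows the constants. *)
case=> [D2 [e2 [_ h2]]]; exists (D1 + D2 + 9), ((e1 + 1) * e2 + e1 + e1 + e1 +
  5) => K hK.
have [|ct hct] := h1 K [::] 4 (leqnn 4) _ isT; first lia.
have [|ct' hct'] := h1 K [::] 5 isT _ isT; first lia.
have [|cv hcv] := h2 K [:: 5] 6 isT _ isT; first lia.
pose pre := [:: Const 6 1; Defs.Sub 5 5 6].
pose sto := [:: Add 7 2 3; Add 7 7 5; Store 7 6].
pose post := [:: Const 5 1; Defs.Sub 4 4 5].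
pose inner := While 5 (Seq (Seq (Block pre) cv) (Block sto)).
pose outer := While 4 (Seq (Seq ct' inner) (Block post)).
exists (Seq ct outer) => t m hm.
set B := (size (bits t)).+2; pose W c := V (set_cells t c).
set X := B ^ ((e1 + 1) * e2).
have run_inner k c m1 : rep K (set_cells t c) m1 -> m1 5 = k -> k <= T t ->
    exists m2 tm, [/\ run inner m1 m2 tm, rep K (set_cells t (pass W k c)) m2,
      m2 4 = m1 4 & tm <= k * (X + 7) + 1].
  elim: k c m1 => [|k IH] c m1 hr h5 le_k.
    by exists m1, 1; split=> //; apply: RunStop.
  set m2 := foldl effect m1 pre.
  have s2 : same_but 5 K m1 m2 by rewrite /m2 => i hi; mem.
  have v2 : m2 5 = k by rewrite /m2; mem.
  have hr2 := rep_same (isT : 4 <= 5) s2 hr.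
  have [//|m3 [t3 [r3 v3 s3 le3]]] := hcv (set_cells t c, k) m2.
  have hr3 := rep_same (isT : 4 <= 6) s3 hr2.
  rewrite /= in v3 le3; set m4 := foldl effect m3 sto.
  have lt_K : K < m3 2 by have := rep_gap hr3; lia.
  have v5 : m3 5 = k by rewrite s3.
  have m3K := rep_const hr3.
  have v4 i : m4 i = if i == 7 then m3 2 + K + k else
      if i == m3 2 + K + k then m3 6 else m3 i.
    by rewrite /m4 -v5 -m3K; mem.
  set c' := fun a => if a == k then c k || W c k else c a.
  have hr4 : rep K (set_cells t c') m4.
    case: (hr3) => q0 q1 q3 qg ql qh qc.
    have v42 : m4 2 = m3 2 by rewrite v4; mem.
    split; rewrite ?v42 //; try by (rewrite v4; mem).
    - by move=> j hj; rewrite v4 -ql //; mem.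
    - by move=> j hj; rewrite v4 -qh //; move: hj qg; rewrite /=; mem.
    - move=> a; rewrite v4 /c' /=; have := qc a; rewrite /= v3.
      by mem.
  have [||m5 [t5 [r5 hr5 v55 le5]]] := IH c' m4 hr4; [by rewrite v4; mem|lia|].
  exists m5, (2 + t3 + 3 + t5).+2; split=> //.
  - apply: RunIter r5; first by rewrite h5.
    exact: RunSeq (RunSeq (RunBlock (l := pre) _ _) r3) (RunBlock (l := sto) _ _).
  - by rewrite v55 v4; mem; rewrite s3 //= s2.
  - have : t3 <= X; last by lia.
    apply: leq_trans le3 _; rewrite /X expnM.
    case: (e2) => // e; rewrite leq_exp2r //.
    have := b1 t; rewrite expnD expn1 -/B /=; have : 0 < B ^ e1 by rewrite expn_gt0.
    by rewrite /B; move: (_ ^ e1) => Y; nia.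
have run_outer k m1 c : rep K (set_cells t c) m1 -> m1 4 = k ->
    exists m2 tm, [/\ run outer m1 m2 tm,
      rep K (set_cells t (iter k (pass W (T t)) c)) m2 &
      tm <= k * (B ^ e1 + T t * (X + 7) + 5) + 1].
  elim: k m1 c => [|k IH] m1 c hr h4.
    by exists m1, 1; split=> //; apply: RunStop.
  have [m2 [t2 [r2 v2 s2 le2]]] := hct' (set_cells t c) m1 hr.
  rewrite /= T_cells in v2 le2.
  have hr2 := rep_same (isT : 4 <= 5) s2 hr.
  have [m3 [t3 [r3 hr3 v3 le3]]] := run_inner _ _ _ hr2 v2 (leqnn _).
  set m4 := foldl effect m3 post.
  have s4 : same_but 4 K m3 m4 by move=> i hi; rewrite /m4; mem.
  have v4 : m4 4 = k by rewrite /m4; mem; rewrite v3 s2 ?h4 //; lia.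
  have [m5 [t5 [r5 hr5 le5]]] := IH m4 _ (rep_same (leqnn 4) s4 hr3) v4.
  exists m5, (t2 + t3 + 2 + t5).+2; split; rewrite ?iterSr //.
    apply: RunIter r5; first by rewrite h4.
    exact: RunSeq (RunSeq r2 r3) (RunBlock (l := post) _ _).
  by rewrite -/B in le2; lia.
have [m1 [t1 [r1 v1 s1 le1]]] := hct t m hm.
have hr1 : rep K (set_cells t (cells t)) m1.
  by apply: rep_same (leqnn 4) s1 _; case: (t) hm.
have [m2 [t2 [r2 hr2 le2]]] := run_outer _ _ _ hr1 v1.
exists m2, (t1 + t2); split=> //; first exact: RunSeq r1 r2.
rewrite /= -/B in le1; have hT : T t <= B ^ e1 := b1 t.
have Y_gt0 : 0 < B ^ e1 by rewrite expn_gt0.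
have X_gt0 : 0 < X by rewrite expn_gt0.
have Z_ge : 16 <= B ^ 5 by apply: (@leq_trans (2 ^ 5)); rewrite ?leq_exp2r.
rewrite !expnD -/X.
move: (B ^ e1) (B ^ 5) hT Y_gt0 Z_ge le1 le2 => Y Z hT Y_gt0 Z_ge le1 le2.
have hY : Y <= Y * Y by rewrite leq_pmulr.
have hXY : Y * Y <= X * (Y * Y) by rewrite leq_pmull.
have hTX : T t * (Y + T t * (X + 7) + 5) <= Y * (Y + Y * (X + 7) + 5).
  by rewrite leq_mul // leq_add2r leq_add2l leq_mul.
have hYX : Y * (Y + Y * (X + 7) + 5) = X * (Y * Y) + 8 * (Y * Y) + 5 * Y by lia.
apply: (@leq_trans (X * (Y * Y) * 16)); first by lia.
have -> : X * Y * Y * Y * Z = X * (Y * Y) * (Y * Z) by lia.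
by rewrite leq_mul // (leq_trans Z_ge) // leq_pmull.
Qed.

Definition final_cells (T : inp -> nat) (V : inp -> nat -> bool) (t : inp) : inp :=
  set_cells t (iter (T t) (pass (fun c => V (set_cells t c)) (T t)) (cells t)).

(** * Relocation of the input and assembly of the machine *)

Lemma halts_within_mono M m t t' out :
  halts_within M m t out -> t <= t' -> halts_within M m t' out.
Proof.
rewrite /halts_within => -[hpc h0] /subnK <-; rewrite iterD.
set c := iter t _ _ in hpc h0 *.
suff -> : iter (t' - t) (step M) c = c by [].
elim: (t' - t) => //= n ->; rewrite /step.
by move: hpc => /(onth_default (s := M)) ->.
Qed.

(** Unrolled because only registers 0 and 1 are available: 1 is the destination pointer and 0 holds
    its increment. *)
Definition save (K : nat) : seq instr :=
  flatten [seq [:: Store 1 j.+2; Add 1 1 0] | j <- iota 0 K].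

(* When it starts, every register but 0 and 1 may hold a bit of the input. As
   k <= 1, both k and size x can be recovered from the sum 2 * size x + k, so
   register 0 is free for scratch while the bits are saved. *)
Definition relocate (K : nat) : seq instr :=
  [:: Add 1 1 1; Add 1 1 0; Const 0 (K + 3); Add 1 1 0; Const 0 1] ++ save K ++
  [:: Const 3 K; Defs.Sub 2 1 3; Const 4 (K + 3); Defs.Sub 1 2 4; Half 4 1;
      Add 5 4 4; Defs.Sub 0 1 5; Const 5 0; Add 1 4 5].

(** The sources are the registers 2 to [K + 1]; the destination starts above them, so no bit is
    overwritten before it is copied. *)
Lemma save_effect K k m : m 0 = 1 -> K + 1 < m 1 -> k <= K ->
  foldl effect m (save k) 1 = m 1 + k /\
  forall i, i != 1 -> foldl effect m (save k) i =
    if m 1 <= i < m 1 + k then m (i - m 1 + 2) else m i.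
Proof.
move=> m0 m1; elim: k => [|k IH] le_k.
  by rewrite addn0; split=> // i _; rewrite ifF //; lia.
rewrite /save -(addn1 k) iotaD map_cat flatten_cat foldl_cat add0n -/(save k).
have [h1 hi] := IH (ltnW le_k); set m' := foldl _ _ (save k) in h1 hi *.
have h0 : m' 0 = 1 by rewrite hi // m0 ifF //; lia.
have hk : m' k.+2 = m k.+2 by rewrite hi // ifF //; lia.
split=> [|i i1]; first by mem.
have [->|i_neq] := eqVneq i (m 1 + k).
  by rewrite ifT; [mem; rewrite hk; congr m; lia | lia].
have -> : (m 1 <= i < m 1 + (k + 1)) = (m 1 <= i < m 1 + k) by lia.
by rewrite -hi //; mem.
Qed.

(** The new base [2 * size x + f + K + 3] lies beyond the input, so the cells behind the saved bits
    are still zero, as the all-false cell function requires. *)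
Lemma relocate_rep K (f : bool) x (m : memory) : 6 <= K -> m 0 = f ->
  m 1 = size x ->
  (forall j, m j.+2 = nth false x j) ->
  rep K (Inp f x (fun=> false)) (foldl effect m (relocate K)).
Proof.
move=> K6 m0 m1 mx; rewrite /relocate !foldl_cat.
set m2 := foldl effect m _.
have m20 : m2 0 = 1 by rewrite /m2; mem.
have m21 : m2 1 = 2 * size x + f + K + 3 by rewrite /m2; mem.
have m2x j : m2 j.+2 = nth false x j by rewrite -mx /m2; mem.
have [|] := save_effect (m := m2) (K := K) m20 _ (leqnn K);
  first by rewrite m21; lia.
set m3 := foldl effect m2 _; set P := m2 1 in m21 *.
move=> m31 m3i; set m4 := foldl effect m3 _.
have m4i i : 6 <= i -> m4 i = m3 i by move=> hi; rewrite /m4; mem.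
have nth_big j : size x <= j -> nat_of_bool (nth false x j) = 0.
  by move=> hj; rewrite nth_default.
have [v0 v1 v2 v3] : [/\ m4 0 = f, m4 1 = size x, m4 2 = P & m4 3 = K].
  rewrite /m4 /= /effect /= /upd /= m31 addnK.
  (* Halving recovers [size x], and the parity is the flag. *)
  have -> : P - (K + 3) = f + (size x).*2 by rewrite m21; lia.
  by rewrite half_bit_double -addnn addnK addn0.
split; rewrite ?v0 ?v1 ?v2 ?v3 //=; first lia.
- move=> j hj; rewrite m4i; last lia.
  rewrite m3i; last lia.
  by rewrite ifT ?addKn ?addn2 ?m2x //; lia.
- move=> j hj; rewrite m4i; last lia.
  rewrite m3i; last lia.
  by rewrite ifF ?addn2 ?m2x //; lia.
- move=> a; rewrite m4i; last lia.
  rewrite m3i; last lia.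
  rewrite ifF; last lia.
  have -> : P + K + a = (P + K + a - 2).+2 by lia.
  by rewrite m2x nth_big //; lia.
Qed.

Lemma poly_bound (e n : nat) :
  ((('X + 2%:P) ^+ e : {poly nat}).[n])%R = n.+2 ^ e.
Proof. by rewrite horner_exp hornerD hornerX hornerC !natrE addn2. Qed.

(** The machine-independent interface: it remains to give a number of cells, a deletion test and an
    acceptance test, all polynomial-time, and to prove an equivalence. *)
Lemma FPT_final_cells (Q : param_problem) (T : inp -> nat)
    (V : inp -> nat -> bool) (G : inp -> bool) :
  (forall t c, T (set_cells t c) = T t) ->
  polytime (T : Ctx 0 -> nat) -> polytime (fun t : Ctx 1 => V t.1 t.2) ->
  polytime (fun t : Ctx 0 => G t) ->
  (forall x k, Q x k <->
     k <= 1 /\ G (final_cells T V (Inp (k == 1) x (fun=> false)))) ->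
  FPT Q.
Proof.
move=> T_cells hT hV [D2 [e2 [_ h2]]] hQ.
have [D1 [e1 h1]] := pass_run T_cells hT hV.
pose K := D1 + D2 + 6.
have [|c1 {}h1] := h1 K; first by rewrite /K; lia.
have [|c2 {}h2] := h2 K [::] 4 isT _ isT; first by rewrite /K; lia.
pose main := Seq (Seq (Seq (Block (relocate K)) c1) c2) (Block [:: Const 0 0;
  Add 0 4 0]).
(* Halving separates [k = 1] from [k >= 2]: in the first case the flag 1 is restored at instruction
   5, in the second the machine leaves the program with output 0. *)
pose start := [:: JumpZ 0 6; Half 0 0; JumpZ 0 5; Const 0 0;
  Jump (6 + csize main); Const 0 1].
pose M := start ++ compile main 6.
have size_M : size M = 6 + csize main by rewrite size_cat size_compile.
pose e := size (relocate K) + e1 + e2 + 20.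
(* The running time is polynomial in [size x] alone, uniformly in [k]. *)
exists M, (fun=> 1), (('X + 2%:P) ^+ e)%R; split.
  by exists [:: Const 0 1] => k; exists 1.
move=> x k; rewrite mul1n poly_bound; set B := (size x).+2.
have step_start i m a : onth start i = Some a -> step M (i, m) = exec a (i, m).
  by move=> hi; rewrite /step /M -[(i, m).1]/i onth_cat;
    case: ltnP hi => [_ ->|/(onth_default (s := start))->].
have run_main m m' tm : run main m m' tm -> iter tm (step M) (6, m) = (size M, m').
  by rewrite size_M => /compile_run/(_ start [::]); rewrite cats0.
clearbody M.
have e20 : 20 <= e by rewrite /e; lia.
have lt_e : e < B ^ e by apply: ltn_expl.
have [k_gt1|k_le1] := ltnP 1 k.
  exists 0; last by split=> // /hQ[]; lia.
  apply: (halts_within_mono (t := 5)); last by lia.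
  rewrite /halts_within /= (step_start 0 _ _ erefl) /= /input gtn_eqF /=;
    last by lia.
  rewrite (step_start 1 _ _ erefl) /= (step_start 2 _ _ erefl) /= /upd /=.
  rewrite gtn_eqF /=; last by rewrite half_gt0.
  by rewrite (step_start 3 _ _ erefl) /= (step_start 4 _ _ erefl) /= size_M.
have [m0 [t0 [le_t0 run0 m00 m01 m0x]]] : exists m0 t0, [/\ t0 <= 4,
    iter t0 (step M) (0, input x k) = (6, m0), m0 0 = (k == 1), m0 1 = size x &
    forall j, m0 j.+2 = nth false x j].
  case: k k_le1 => [_|[|//] _].
    by exists (input x 0), 1; split=> //=; rewrite (step_start 0 _ _ erefl).
  exists (upd (upd (input x 1) 0 0) 0 1), 4; split=> //=.
  rewrite (step_start 0 _ _ erefl) /= (step_start 1 _ _ erefl) /=.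
  by rewrite (step_start 2 _ _ erefl) /= (step_start 5 _ _ erefl).
have [m2 [t2 [r2 le2 hr2]]] := h1 _ _ (relocate_rep (leq_addl _ _) m00 m01 m0x).
have [m3 [t3 [r3 v3 s3 le3]]] := h2 (final_cells T V (Inp (k == 1) x (fun=>
  false))) m2 hr2.
exists (m3 4); last first.
  by rewrite v3; split=> [|/hQ[_ ->]] //; case hG: (G _) => // _; apply/hQ.
apply: (halts_within_mono (t := size (relocate K) + t2 + t3 + 2 + t0)); last first.
  have := leq_add_expn (isT : 2 <= B) le2 le3.
  rewrite /= -/B in le2 le3.
  move=> h; apply: (@leq_trans (B ^ (size (relocate K) + 8 + (e1 + e2).+1).+1)).
    apply: (@leq_trans (size (relocate K) + 8 + (t2 + t3))); first by lia.
    by apply: leq_add_expn h => //; apply: leq_const_expn.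
  by rewrite leq_exp2l // /e; lia.
rewrite /halts_within iterD run0.
pose m3' := foldl effect m3 [:: Const 0 0; Add 0 4 0].
rewrite (run_main _ m3' _ (RunSeq (RunSeq (RunSeq (RunBlock m0 _) r2) r3)
  (RunBlock _ _))) //.
  by split=> //=; rewrite /m3'; mem.
by rewrite !all_cat /save /=; elim: (iota 0 K) => //=.
Qed.

(** * The evaluation of a formula on codes of assignments *)

(** The length of the leading block of ones, the unary domain size of an encoding, in a form built
    from bounded sums and quantifiers. *)
Definition dom_size (x : seq bool) : nat :=
  \sum_(i < size x) all (nth false x) (iota 0 i.+1).

(** A number [s < n ^ m] codes the assignment that maps each variable [v < m] to the element
    numbered by this digit. *)
Definition digit (n s v : nat) : nat := (s %/ n ^ v) %% n.

Definition of_digits (n r : nat) (c : 'I_r ->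
  nat) : nat := \sum_(i < r) c i * n ^ i.

Definition offset (I : eqType) (sz : I -> nat) (l : seq I) (i : I) : nat :=
  \sum_(j <- take (index i l) l) sz j.

Definition rel_pos sg (n : nat) (R : relS sg) : nat :=
  n.+1 + offset (fun R' => n ^ rel_ar R') (enum (relS sg)) R.

Definition fun_pos sg (n : nat) (f : funS sg) : nat :=
  n.+1 + \sum_(R <- enum (relS sg)) n ^ rel_ar R
  + offset (fun g => n ^ (fun_ar g).+1) (enum (funS sg)) f.

(** In a valid input each argument tuple has exactly one true bit in the graph table, so the sum of
    the candidates [v] weighted by their bits is the value of the function. The value is the last,
    most significant coordinate of a tuple, whence the factor [dom_size x ^ fun_ar f]. *)
Fixpoint tcode sg (x : seq bool) (s : nat) (t : term sg) : nat :=
  match t with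
  | Var v => digit (dom_size x) s v
  | App f ts => \sum_(v < dom_size x) v * nth false x (fun_pos (dom_size x) f +
      (of_digits (dom_size x) (fun i =>
        tcode x s (ts i)) + v * dom_size x ^ fun_ar f))
  end.

Definition rel_bit sg (x : seq bool) (s : nat) (R : relS sg)
    (ts : 'I_(rel_ar R) -> term sg) : bool :=
  nth false x (rel_pos (dom_size x) R + of_digits (dom_size x) (fun i =>
    tcode x s (ts i))).

Definition agree_off (n m v s s' : nat) : bool :=
  all (fun y => (y == v) || (digit n s y == digit n s' y)) (iota 0 m).

Fixpoint nodes sg (phi : formula sg) : nat :=
  match phi with
  | And p r | Or p r => (nodes p + nodes r).+1
  | Ex _ p | All _ p => (nodes p).+1
  | _ => 1
  end.

(* The subformulas are numbered in prefix order from q on and L j is the team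
   of the subformula j; [viol phi q L j s] says that s belongs to L j against
   the clause of the semantics for a subformula j of phi or for its parent. *)
Fixpoint viol sg (x : seq bool) (m : nat) (phi : formula sg) (q : nat)
    (L : nat -> nat -> bool) (j s : nat) : bool :=
  let some P := has P (iota 0 (dom_size x ^ m)) in
  match phi with
  | Rel R ts => (j == q) && ~~ rel_bit x s ts
  | NRel R ts => (j == q) && rel_bit x s ts
  | Eq t u => (j == q) && (tcode x s t != tcode x s u)
  | Neq t u => (j == q) && (tcode x s t == tcode x s u)
  | Inc k ts us => (j == q) && ~~ some (fun s' => L q s' &&
      all (fun i => tcode x s (ts i) == tcode x s' (us i)) (enum 'I_k))
  | And p r =>
      let q' := q.+1 + nodes p in
      [|| (j == q) && ~~ (L q.+1 s && L q' s),
          ((j == q.+1) || (j == q')) && ~~ L q s,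
          viol x m p q.+1 L j s | viol x m r q' L j s]
  | Or p r =>
      let q' := q.+1 + nodes p in
      [|| (j == q) && ~~ (L q.+1 s || L q' s),
          ((j == q.+1) || (j == q')) && ~~ L q s,
          viol x m p q.+1 L j s | viol x m r q' L j s]
  | Ex v p =>
      [|| (j == q) && ~~ some (fun s' =>
        agree_off (dom_size x) m v s s' && L q.+1 s'),
          (j == q.+1) && ~~ some (fun s' =>
            agree_off (dom_size x) m v s s' && L q s') |
          viol x m p q.+1 L j s]
  | All v p =>
      [|| (j == q) && some (fun s' => agree_off (dom_size x) m v s s' && ~~ L
        q.+1 s'),
          (j == q.+1) && ~~ some (fun s' =>
            agree_off (dom_size x) m v s s' && L q s') |
          viol x m p q.+1 L j s]
  end.

(** Relation tables may be arbitrary; a function table must pick exactly one value for each argument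
    tuple. *)
Definition valid sg (x : seq bool) : bool :=
  let n := dom_size x in
  [&& 0 < n,
      size x == n.+1 + \sum_(R <- enum (relS sg)) n ^ rel_ar R
        + \sum_(f <- enum (funS sg)) n ^ (fun_ar f).+1,
      ~~ nth false x n &
      all (fun f => all (fun w =>
          \sum_(v < n) nth false x (fun_pos n f + (w + v * n ^ fun_ar f)) == 1)
        (iota 0 (n ^ fun_ar f))) (enum (funS sg))].

(** * Polynomial time of the evaluation *)

Section PolytimeEvaluation.
Variables (sg : signature) (d : nat).
Implicit Types S J : Ctx d -> nat.

Lemma polytime_dom_size : polytime (fun t : Ctx d => dom_size (bits (base t))).
Proof.
apply: (polytime_sum (G := fun t i =>
  all (nth false (bits (base t))) (iota 0 i.+1)))
  (polytime_size _) _.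
apply: (polytime_all (P := fun t i => nth false (bits (base t)) i)).
  by apply: polytime_ext (polytime_add (polytime_const 1) (polytime_last _)).
by apply: polytime_bit; apply: polytime_last.
Qed.

Lemma polytime_offset (I : eqType) (k : I -> nat) l i :
  polytime (fun t : Ctx d => offset (fun j => dom_size (bits (base t)) ^ k j) l i).
Proof. by apply: polytime_bigsum => j; apply/polytime_exp/polytime_dom_size. Qed.

Lemma polytime_dom_sizeS : polytime (fun t : Ctx d =>
  (dom_size (bits (base t))).+1).
Proof. exact: (polytime_add (polytime_const 1) polytime_dom_size). Qed.

Lemma polytime_rel_pos (R : relS sg) :
  polytime (fun t : Ctx d => rel_pos (dom_size (bits (base t))) R).
Proof. exact: polytime_add polytime_dom_sizeS (polytime_offset _ _ _). Qed.

Lemma polytime_fun_pos (f : funS sg) :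
  polytime (fun t : Ctx d => fun_pos (dom_size (bits (base t))) f).
Proof.
apply: polytime_add (polytime_offset _ _ _);
  apply: polytime_add polytime_dom_sizeS _.
by apply: polytime_bigsum => R; apply/polytime_exp/polytime_dom_size.
Qed.

Lemma polytime_digit S v : polytime S ->
  polytime (fun t => digit (dom_size (bits (base t))) (S t) v).
Proof.
move=> hS; apply: polytime_mod polytime_dom_size; apply: polytime_div hS _.
exact/polytime_exp/polytime_dom_size.
Qed.

Lemma polytime_of_digits r (c : 'I_r -> Ctx d -> nat) :
  (forall i, polytime (c i)) ->
  polytime (fun t => of_digits (dom_size (bits (base t))) (fun i => c i t)).
Proof.
move=> hc; apply: polytime_bigsum => i; apply: polytime_mul (hc i) _.
exact/polytime_exp/polytime_dom_size.
Qed.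

Lemma polytime_tcode S (u : term sg) : polytime S ->
  polytime (fun t => tcode (bits (base t)) (S t) u).
Proof.
move=> hS; elim: u => [v|f ts IH] /=; first exact: polytime_digit.
apply: (polytime_sum (G := fun t v => v * nth false (bits (base t))
  (fun_pos (dom_size (bits (base t))) f +
   (of_digits (dom_size (bits (base t))) (fun i =>
     tcode (bits (base t)) (S t) (ts i))
    + v * dom_size (bits (base t)) ^ fun_ar f)))) polytime_dom_size _.
apply: polytime_mul (polytime_last _) _; apply: polytime_bit.
apply: polytime_add; first exact: polytime_prev (polytime_fun_pos f).
apply: polytime_add; first exact: polytime_prev (polytime_of_digits IH).
apply: polytime_mul (polytime_last _) _.
exact: (polytime_prev (polytime_exp _ polytime_dom_size)).
Qed.

Lemma polytime_rel_bit S (R : relS sg) (ts : 'I_(rel_ar R) -> term sg) :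
  polytime S -> polytime (fun t => rel_bit (bits (base t)) (S t) ts).
Proof.
move=> hS; apply: polytime_bit; apply: polytime_add (polytime_rel_pos R) _.
by apply: polytime_of_digits => i; apply: polytime_tcode.
Qed.

Lemma polytime_agree_off m v S J : polytime S -> polytime J ->
  polytime (fun t => agree_off (dom_size (bits (base t))) m v (S t) (J t)).
Proof.
move=> hS hJ; apply: polytime_all_seq => y; apply: polytime_or.
  exact: polytime_const.
by apply: polytime_eq; apply: polytime_digit.
Qed.

Lemma polytime_valid : polytime (fun t : Ctx d => valid sg (bits (base t))).
Proof.
have hn := polytime_dom_size; apply: polytime_and;
  first exact: polytime_leq (polytime_const 1) hn.
apply: polytime_and.
  apply: polytime_eq (polytime_size _) _.
  by apply: polytime_add; [apply: polytime_add polytime_dom_sizeS _ |];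
    apply: polytime_bigsum => i; apply: polytime_exp.
apply: polytime_and; first exact/polytime_neg/polytime_bit.
apply: polytime_all_seq => f.
apply: (polytime_all (P := fun t w => \sum_(v < dom_size (bits (base t)))
  nth false (bits (base t)) (fun_pos (dom_size (bits (base t))) f
  + (w + v * dom_size (bits (base t)) ^ fun_ar f)) == 1)) (polytime_exp _ hn) _.
apply: polytime_eq (polytime_const 1).
apply: (polytime_sum (d := d.+1) (G := fun t v => nth false (bits (base t.1))
  (fun_pos (dom_size (bits (base t.1))) f + (t.2 + v * dom_size (bits (base
    t.1)) ^ fun_ar f))))
  (polytime_prev hn) _.
apply/polytime_bit/polytime_add.
  exact: (polytime_prev (polytime_prev (polytime_fun_pos f))).
apply: polytime_add; first exact: (polytime_prev (polytime_last d)).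
apply: polytime_mul (polytime_last _) _.
exact: (polytime_prev (polytime_prev (polytime_exp _ hn))).
Qed.

End PolytimeEvaluation.

(* A true cell marks a deleted assignment, so that the zeroed memory beyond the
   input represents the full teams. *)
Definition team_of (m : nat) (t : inp) (j s : nat) : bool :=
  ~~ cells t (j * dom_size (bits t) ^ m + s).

Lemma polytime_team_of d m q (S : Ctx d -> nat) : polytime S ->
  polytime (fun t => team_of m (base t) q (S t)).
Proof.
move=> hS; apply/polytime_neg/polytime_cell/polytime_add => //.
apply: polytime_mul (polytime_const q) _; exact/polytime_exp/polytime_dom_size.
Qed.

Lemma polytime_viol sg d m (phi : formula sg) q (J S : Ctx d -> nat) :
  polytime J -> polytime S ->
  polytime (fun t => viol (bits (base t)) m phi q (team_of m (base t)) (J t) (S t)).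
Proof.
move=> hJ hS; have hN := polytime_exp m (polytime_dom_size d).
have at_node k : polytime (fun t => J t == k) := polytime_eq hJ (polytime_const k).
have hS' := polytime_prev hS; have hv := polytime_last d.
(* The bit [b] negates membership, which covers the downward clause of the universal quantifier as
   well. *)
have near v k (b : bool) : polytime (fun t => has (fun s' =>
    agree_off (dom_size (bits (base t))) m v (S t) s' && (b (+) team_of m (base
      t) k s'))
    (iota 0 (dom_size (bits (base t)) ^ m))).
  apply: (polytime_has (P := fun t s' =>
    agree_off (dom_size (bits (base t))) m v (S t) s' &&
    (b (+) team_of m (base t) k s'))) hN _.
  apply: polytime_and; first exact: polytime_agree_off.
  by case: b => /=; [apply: polytime_neg|]; apply: polytime_team_of.
elim: phi q => [R ts|R ts|u w|u w|k us ws|p IHp r IHr|p IHp r IHr|v p IHp|v p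
  IHp] q /=.
- by apply: polytime_and => //; apply/polytime_neg/polytime_rel_bit.
- by apply: polytime_and => //; apply: polytime_rel_bit.
- by apply: polytime_and => //; apply/polytime_neg/polytime_eq;
    apply: polytime_tcode.
- by apply: polytime_and => //; apply/polytime_eq; apply: polytime_tcode.
- apply: polytime_and => //; apply: polytime_neg.
  apply: (polytime_has (P := fun t s' => team_of m (base t) q s' &&
    all (fun i => tcode (bits (base t)) (S t) (us i) == tcode (bits (base t))
      s' (ws i))
    (enum 'I_k))) hN _.
  apply: polytime_and; first exact: polytime_team_of.
  by apply: polytime_all_seq => i; apply: polytime_eq; apply: polytime_tcode.
- apply: polytime_or.
    by apply: polytime_and => //; apply/polytime_neg/polytime_and;
      apply: polytime_team_of.
  apply: polytime_or; last exact: polytime_or.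
  by apply: polytime_and; [apply: polytime_or |
    apply/polytime_neg/polytime_team_of].
- apply: polytime_or.
    by apply: polytime_and => //; apply/polytime_neg/polytime_or;
      apply: polytime_team_of.
  apply: polytime_or; last exact: polytime_or.
  by apply: polytime_and; [apply: polytime_or |
    apply/polytime_neg/polytime_team_of].
- apply: polytime_or; first exact: polytime_and (at_node q) (polytime_neg (near
    v q.+1 false)).
  apply: polytime_or => //.
  exact: polytime_and (at_node q.+1) (polytime_neg (near v q false)).
- apply: polytime_or; first exact: polytime_and (at_node q) (near v q.+1 true).
  apply: polytime_or => //.
  exact: polytime_and (at_node q.+1) (polytime_neg (near v q false)).
Qed.

(** * Encodings of structures *)

Lemma of_digits_recl n r (c : 'I_r.+1 -> nat) :
  of_digits n c = c ord0 + n * of_digits n (fun i => c (lift ord0 i)).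
Proof.
rewrite /of_digits big_ord_recl expn0 muln1 big_distrr; congr (_ + _).
by apply: eq_bigr => i _; rewrite /= /bump expnS mulnCA.
Qed.

Lemma of_digits_lt n r (c : 'I_r -> nat) : (forall i, c i < n) ->
  of_digits n c < n ^ r.
Proof.
elim: r c => [|r IH] c hc; first by rewrite /of_digits big_ord0.
rewrite of_digits_recl expnS.
apply: (@leq_trans (n * (of_digits n (fun i => c (lift ord0 i))).+1)).
  by rewrite mulnS -addSn leq_add2r hc.
by rewrite leq_pmul2l ?IH //; apply: leq_ltn_trans (hc ord0).
Qed.

Lemma digit_of_digits n r (c : 'I_r -> nat) (i : 'I_r) : (forall i, c i < n) ->
  digit n (of_digits n c) i = c i.
Proof.
elim: r c i => [|r IH] c i hc; first by case: i.
have n_gt0 : 0 < n by apply: leq_ltn_trans (hc i).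
rewrite of_digits_recl /digit addnC mulnC; case: (unliftP ord0 i) => [j|] -> /=.
  by rewrite /bump /= expnS divnMA divnMDl // [_ %/ n]divn_small // addn0
    -/(digit _ _ _) IH.
by rewrite divn1 modnMDl modn_small.
Qed.

Lemma of_digits_digit n r s : s < n ^ r -> of_digits n (fun i : 'I_r =>
  digit n s i) = s.
Proof.
elim: r s => [|r IH] s hs; first by rewrite /of_digits big_ord0; case: s hs.
have n_gt0 : 0 < n by case: (posnP n) hs => // ->; rewrite exp0n.
rewrite of_digits_recl /digit divn1 /= addnC {3}(divn_eq s n) mulnC;
  congr (_ * _ + _).
rewrite -[RHS]IH; last by rewrite ltn_divLR // -expnSr.
by apply: eq_bigr => i _; rewrite /bump /= /digit expnS divnMA.
Qed.

Lemma digit_lt n s v : 0 < n -> digit n s v < n.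
Proof. exact: ltn_pmod. Qed.

Lemma dom_size_spec n x : n < size x -> (forall i, i < n -> nth false x i) ->
  ~~ nth false x n -> dom_size x = n.
Proof.
move=> lt_n x1 x0; rewrite /dom_size.
rewrite -(big_mkord xpredT (fun i =>
  nat_of_bool (all (nth false x) (iota 0 i.+1)))).
rewrite (big_cat_nat (leq0n n) (ltnW lt_n)) /=.
rewrite (eq_big_nat _ _ (F2 := fun=> 1)) => [|i /andP[_ lt_i]]; last first.
  by rewrite -[_ && _]/(all _ (iota 0 i.+1)) (introT allP) // => j;
    rewrite mem_iota => ?; apply: x1; lia.
rewrite [X in _ + X](eq_big_nat _ _ (F2 := fun=> 0)) => [|i /andP[le_i _]];
  last first.
  rewrite -[_ && _]/(all _ (iota 0 i.+1)); case: allP => // /(_ n).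
  by rewrite mem_iota ltnS le_i (negbTE x0) => /(_ isT).
by rewrite !sum_nat_const_nat muln0 addn0 muln1 subn0.
Qed.

Lemma dom_size_ones x i : i < dom_size x -> nth false x i.
Proof.
case xi: (nth false x i) => //; rewrite ltnNge => /negP[].
rewrite /dom_size -(big_mkord xpredT (fun i =>
  nat_of_bool (all (nth false x) (iota 0 i.+1)))).
have [le_s|lt_s] := leqP (size x) i.
  apply: leq_trans le_s; rewrite -[leqRHS]subn0 -[leqRHS]muln1 -sum_nat_const_nat.
  by apply: leq_sum => j _; case: all.
rewrite (big_cat_nat (leq0n i) (ltnW lt_s)) /=.
rewrite [X in _ + X](eq_big_nat _ _ (F2 := fun=> 0)) => [|j /andP[le_j _]];
  last first.
  rewrite -[_ && _]/(all _ (iota 0 j.+1)); case: allP => // /(_ i).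
  by rewrite mem_iota ltnS le_j xi => /(_ isT).
rewrite sum_nat_const_nat muln0 addn0 -[leqRHS]subn0 -[leqRHS]muln1
  -sum_nat_const_nat.
by apply: leq_sum => j _; case: (_ && _).
Qed.

Lemma nth_flatten_map (I : eqType) (T : Type) (x0 : T) (F : I -> seq T)
    (sz : I -> nat) l i j :
  (forall i, size (F i) = sz i) -> i \in l -> j < sz i ->
  nth x0 (flatten (map F l)) (offset sz l i + j) = nth x0 (F i) j.
Proof.
rewrite /offset => hsz; elim: l => [//|k l IH]; rewrite inE /= eq_sym nth_cat hsz.
have [-> _|ne_ki /= il] := eqVneq k i; first by rewrite /= big_nil add0n => ->.
move=> hj; rewrite big_cons -addnA ltnNge leq_addr /= addKn; exact: IH.
Qed.

(** Tables read off at consecutive offsets glue into one stretch; this puts the re-encoding of a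
    decoded structure back together. *)
Lemma flatten_segments (I : eqType) (T : Type) (g : nat -> T) (sz : I -> nat) l o :
  uniq l ->
  flatten [seq [seq g (o + offset sz l i + j) | j <- iota 0 (sz i)] | i <- l]
  = [seq g (o + j) | j <- iota 0 (\sum_(i <- l) sz i)].
Proof.
elim: l o => [|k l IH] o /=; first by rewrite big_nil.
case/andP=> kl ul; rewrite big_cons iotaD map_cat /offset /= eqxx big_nil addn0.
congr (_ ++ _); rewrite add0n -{1}[sz k]addn0 iotaDl -map_comp.
rewrite (eq_map (g := fun j => g (o + sz k + j))) => [|j /=]; last by rewrite addnA.
rewrite -IH //; congr flatten; apply/eq_in_map => i il; apply: eq_map => j.
have [ki|_] := eqVneq k i; first by rewrite ki il in kl.
by rewrite big_cons addnA.
Qed.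

Lemma unlift_widen r (i : 'I_r) (le_r : r <= r.+1) :
  unlift ord_max (widen_ord le_r i) = Some i.
Proof.
suff -> : widen_ord le_r i = lift ord_max i by rewrite liftK.
by apply: val_inj; rewrite [RHS]lift_max.
Qed.

Section Encoding.
Variables (sg : signature) (A : structure sg).
Implicit Type R : relS sg.
Implicit Type f : funS sg.
Local Notation n := #|A|.
Local Notation x := (encode A).

Definition elt (i : nat) : A := nth (dom_pt A) (enum A) i.

Lemma dom_gt0 : 0 < n.
Proof. by apply/card_gt0P; exists (dom_pt A). Qed.

Lemma elt_inj i j : i < n -> j < n -> (elt i == elt j) = (i == j).
Proof. by move=> hi hj; rewrite nth_uniq ?enum_uniq -?cardE. Qed.

Lemma eltK (a : A) : exists2 i, i < n & elt i = a.
Proof.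
have aA : a \in enum A by rewrite mem_enum inE.
by exists (index a (enum A)); rewrite ?cardE ?index_mem // /elt nth_index.
Qed.

Lemma size_table r (P : {ffun 'I_r -> A} -> bool) : size (table P) = n ^ r.
Proof. by rewrite size_map size_iota. Qed.

Lemma nth_table r (P : {ffun 'I_r -> A} -> bool) j :
  j < n ^ r -> nth false (table P) j = P (word A r j).
Proof. by move=> hj; rewrite (nth_map 0) ?size_iota // nth_iota. Qed.

Lemma word_of_digits r (c : 'I_r -> nat) : (forall i, c i < n) ->
  word A r (of_digits n c) = [ffun i => elt (c i)].
Proof. by move=> hc; apply/ffunP => i;
  rewrite !ffunE -[_ %% _]/(digit _ _ _) digit_of_digits. Qed.

Lemma nth_encode j : nth false x (n.+1 + j) = nth false
  (flatten [seq table (@rel_int _ A R) | R <- enum (relS sg)] ++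
   flatten [seq table (@fun_graph _ A f) | f <- enum (funS sg)]) j.
Proof. by rewrite /encode nth_cat size_nseq ltnNge ltnW ?addSn ?ltnS ?leq_addr
  //= subSn ?leq_addr // addKn. Qed.

Lemma size_encode : size x = n.+1 + \sum_(R <- enum (relS sg)) n ^ rel_ar R
  + \sum_(f <- enum (funS sg)) n ^ (fun_ar f).+1.
Proof.
rewrite /encode size_cat size_nseq /= size_cat !size_flatten /shape -!map_comp
  !sumnE !big_map.
rewrite addnS -addSn addnA; congr (_ + _ + _);
by apply: eq_bigr => i _; rewrite /= size_table.
Qed.

Lemma dom_size_encode : dom_size x = n.
Proof.
apply: dom_size_spec; first by rewrite size_encode; lia.
  by move=> i hi; rewrite nth_cat size_nseq hi nth_nseq hi.
by rewrite nth_cat size_nseq ltnn subnn.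
Qed.

Lemma rel_table R c : (forall i, c i < n) ->
  nth false x (rel_pos n R + of_digits n c) = rel_int (R := R) [ffun i =>
    elt (c i)].
Proof.
move=> hc; have lt_c := of_digits_lt hc.
have hsz R' : size (table (@rel_int _ A R')) = n ^ rel_ar R' := size_table _.
rewrite /rel_pos -addnA nth_encode nth_cat.
have h := nth_flatten_map false hsz (mem_enum _ R) lt_c.
have lt_o : offset (fun R' => n ^ rel_ar R') (enum (relS sg)) R + of_digits n c <
    size (flatten [seq table (@rel_int _ A R) | R <- enum (relS sg)]).
  rewrite size_flatten /shape -map_comp sumnE big_map.
  under eq_bigr do rewrite /= hsz.
  rewrite -[X in _ < \sum_(_ <- X) _](cat_take_drop (index R (enum (relS sg)))).
  rewrite big_cat ltn_add2l (drop_nth R) ?index_mem ?mem_enum // nth_index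
    ?mem_enum //.
  by rewrite big_cons ltn_addr.
by rewrite lt_o h nth_table // word_of_digits.
Qed.

Lemma fun_table f c v : (forall i, c i < n) -> v < n ->
  nth false x (fun_pos n f + (of_digits n c + v * n ^ fun_ar f))
  = (fun_int (f := f) [ffun i => elt (c i)] == elt v).
Proof.
move=> hc hv; pose c' (i : 'I_(fun_ar f).+1) := oapp c v (unlift ord_max i).
have hc' i : c' i < n by rewrite /c'; case: unliftP => [j _|_] /=.
have -> : of_digits n c + v * n ^ fun_ar f = of_digits n c'.
  rewrite /of_digits big_ord_recr /c' unlift_none; congr (_ + _).
  by apply: eq_bigr => i _; rewrite unlift_widen.
have hsz f' : size (table (@fun_graph _ A f')) = n ^ (fun_ar f').+1 := size_table _.
rewrite /fun_pos -!addnA nth_encode nth_cat.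
have -> : size (flatten [seq table (@rel_int _ A R) | R <- enum (relS sg)]) =
    \sum_(R <- enum (relS sg)) n ^ rel_ar R.
  rewrite size_flatten /shape -map_comp sumnE big_map.
  by apply: eq_bigr => i _; rewrite /= size_table.
rewrite ltnNge leq_addr addKn /= (nth_flatten_map false hsz (mem_enum _ f)
  (of_digits_lt hc')).
rewrite nth_table ?of_digits_lt // word_of_digits // /fun_graph ffunE /c'
  unlift_none.
congr (fun_int _ == _); apply/ffunP => i; rewrite !ffunE.
by rewrite unlift_widen.
Qed.

Lemma sum_fun_table f c : (forall i, c i < n) -> exists2 v, v < n /\
  elt v = fun_int (f := f) [ffun i => elt (c i)] &
  forall u, u < n ->
  nth false x (fun_pos n f + (of_digits n c + u * n ^ fun_ar f)) = (u == v).
Proof.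
move=> hc; have [v lt_v hv] := eltK (fun_int (f := f) [ffun i => elt (c i)]).
exists v => // u lt_u; rewrite fun_table // -hv elt_inj //; exact: eq_sym.
Qed.

Lemma sum_eq_op v (F : nat -> nat) : v < n ->
  \sum_(u < n) F u * (u == v :> nat) = F v.
Proof.
move=> lt_v; rewrite (bigD1 (Ordinal lt_v)) //= eqxx muln1 big1 ?addn0 // => i.
by rewrite -val_eqE /= => /negbTE->; rewrite muln0.
Qed.

Lemma tcode_eval s (g : assignment A) (t : term sg) :
  (forall v, v \in term_vars t -> (g.[? v] = Some (elt (digit n s v)))%fmap) ->
  tcode x s t < n /\ eval g t = elt (tcode x s t).
Proof.
elim: t => [v|f ts IH] /= hg; rewrite dom_size_encode.
  by rewrite digit_lt ?dom_gt0 // hg // inE.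
have {}IH i : tcode x s (ts i) < n /\ eval g (ts i) = elt (tcode x s (ts i)).
  by apply: IH => v hv; apply: hg; apply/bigfcupP; exists i;
    rewrite // mem_index_enum.
have [v [lt_v hv] hu] := sum_fun_table (f := f) (fun i => (IH i).1).
under eq_bigr => u _ do rewrite hu //.
rewrite (sum_eq_op id lt_v) hv; split=> //; congr fun_int.
by apply/ffunP => i; rewrite !ffunE (IH i).2.
Qed.

Lemma rel_bit_eval s (g : assignment A) R (ts : 'I_(rel_ar R) -> term sg) :
  (forall i v, v \in term_vars (ts i) ->
    (g.[? v] = Some (elt (digit n s v)))%fmap) ->
  rel_bit x s ts = rel_int (R := R) [ffun i => eval g (ts i)].
Proof.
move=> hg; have h i := tcode_eval (hg i).
rewrite /rel_bit dom_size_encode rel_table => [|i]; last exact: (h i).1.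
by congr rel_int; apply/ffunP => i; rewrite !ffunE (h i).2.
Qed.

Lemma valid_encode : valid sg x.
Proof.
rewrite /valid dom_size_encode dom_gt0 size_encode eqxx nth_cat size_nseq ltnn
  subnn /=.
apply/allP => f _; apply/allP => w; rewrite mem_iota add0n => /= lt_w.
have [|v [lt_v _] hu] := sum_fun_table (f := f) (c := fun i => digit n w i).
  by move=> i; apply: digit_lt dom_gt0.
rewrite of_digits_digit // in hu; under eq_bigr => u _ do rewrite hu //.
apply/eqP; rewrite -[RHS](sum_eq_op (fun=> 1) lt_v).
by apply: eq_bigr => u _; rewrite mul1n.
Qed.

End Encoding.

Section Decoding.
Variables (sg : signature) (x : seq bool).
Hypothesis x_valid : valid sg x.
Local Notation n := (dom_size x).

Let n_gt0 : 0 < n.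
Proof. by case/and4P: x_valid. Qed.

Let decoded_rel (R : relS sg) (w : {ffun 'I_(rel_ar R) -> 'I_n}) : bool :=
  nth false x (rel_pos n R + of_digits n (fun i => w i)).

Let graph_bit (f : funS sg) (w v : nat) : bool :=
  nth false x (fun_pos n f + (w + v * n ^ fun_ar f)).

Let decoded_fun (f : funS sg) (w : {ffun 'I_(fun_ar f) -> 'I_n}) : 'I_n :=
  odflt (Ordinal n_gt0) [pick v : 'I_n | graph_bit f (of_digits n (fun i =>
    w i)) v].

Definition decode : structure sg := Structure (Ordinal n_gt0) decoded_rel
  decoded_fun.

(** Validity says that the bits for [w] sum to 1, hence exactly one value is marked and the default
    in [decoded_fun] is never reached. *)
Lemma decoded_funE f (w : {ffun 'I_(fun_ar f) -> 'I_n}) (v : 'I_n) :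
  (decoded_fun w == v) = graph_bit f (of_digits n (fun i => w i)) v.
Proof.
case/and4P: x_valid => _ _ _ /allP/(_ f (mem_enum _ f))/allP.
move=> /(_ (of_digits n (fun i => w i))); rewrite mem_iota add0n /= of_digits_lt //.
move=> /(_ isT)/sum_nat_eq1[] // u [_ hu others].
rewrite /decoded_fun; case: pickP => [u' hu'|/(_ u)]; last first.
  by move: hu; rewrite -/(graph_bit _ _ _) => + h; rewrite h.
have eq_u (u1 : 'I_n) : graph_bit f (of_digits n (fun i => w i)) u1 -> u1 = u.
  move=> h; apply/eqP; apply: contraTT h => /others;
    rewrite -/(graph_bit _ _ _) => /(_ isT).
  by case: graph_bit.
rewrite /= (eq_u _ hu'); apply/eqP/idP => [<-|/eq_u //].
by move: hu; rewrite -/(graph_bit _ _ _); case: graph_bit.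
Qed.

Lemma word_decode r j (i : 'I_r) : word decode r j i = digit n j i :> nat.
Proof.
rewrite ffunE /= (_ : #|decode| = n) ?card_ord // nth_enum_ord //.
exact: digit_lt n_gt0.
Qed.

(** Together with [valid_encode] this makes [valid] recognise exactly the encodings, so malformed
    strings can be rejected. *)
Lemma encode_decode : x = encode decode.
Proof.
have card_dec : #|decode| = n := card_ord n.
case/and4P: (x_valid) => _ /eqP size_x x0 _.
have rel_tables : [seq table (@rel_int _ decode R) | R <- enum (relS sg)] =
    [seq [seq nth false x (rel_pos n R + j) | j <- iota 0 (n ^ rel_ar R)] |
      R <- enum (relS sg)].
  apply: eq_map => R; rewrite /table card_dec; apply/eq_in_map => j.
  rewrite mem_iota add0n => /= lt_j; rewrite /decoded_rel.
  rewrite -[in RHS](of_digits_digit lt_j); congr (nth _ _ (_ + _)).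
  by apply: eq_bigr => i _; rewrite word_decode.
have fun_tables : [seq table (@fun_graph _ decode f) | f <- enum (funS sg)] =
    [seq [seq nth false x (fun_pos n f + j) | j <- iota 0 (n ^ (fun_ar f).+1)] |
      f <- enum (funS sg)].
  apply: eq_map => f; rewrite /table card_dec; apply/eq_in_map => j.
  rewrite mem_iota add0n => /= lt_j; rewrite /fun_graph /= decoded_funE /graph_bit.
  rewrite -[in RHS](of_digits_digit lt_j) /of_digits big_ord_recr word_decode.
  congr (nth _ _ (_ + (_ + _))).
  by apply: eq_bigr => i _; rewrite ffunE word_decode.
rewrite /encode rel_tables fun_tables card_dec.
rewrite /rel_pos /fun_pos !(flatten_segments (nth false x)) ?enum_uniq //.
set a := \sum_(R <- _) _ in size_x *; set b := \sum_(f <- _) _ in size_x *.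
have -> : [seq nth false x (n.+1 + a + j) | j <- iota 0 b] =
    [seq nth false x (n.+1 + j) | j <- iota a b].
  rewrite -[in RHS](addn0 a) iotaDl -map_comp; apply: eq_map => j /=.
  by rewrite addnA.
(* All tables now form one stretch of [x] starting at [n.+1]; positions are compared below [n] (the
   ones), at [n] (the separator) and above it. *)
rewrite -map_cat -iotaD; apply: (@eq_from_nth _ false) => [|i].
  by rewrite size_x size_cat size_nseq /= size_map size_iota; lia.
move=> lt_i; rewrite nth_cat size_nseq.
case: ltngtP => [lt_in|gt_in|->]; first by rewrite nth_nseq lt_in dom_size_ones.
  have [k hk] : exists k, i = n.+1 + k by exists (i - n.+1); lia.
  have lt_k : k < a + b by rewrite hk size_x in lt_i; lia.
  rewrite (_ : i - n = k.+1) /=; last lia.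
  by rewrite (nth_map 0) ?size_iota // nth_iota // add0n -hk.
by rewrite subnn /= (negbTE x0).
Qed.

End Decoding.

(** * Families of teams and satisfaction *)

Lemma agree_off_sym n m v s s' : agree_off n m v s s' = agree_off n m v s' s.
Proof. by apply: eq_all => y; rewrite [digit n s y == _]eq_sym. Qed.

Lemma nodes_gt0 sg (phi : formula sg) : 0 < nodes phi.
Proof. by case: phi. Qed.

Lemma mem_iota0 N s : (s \in iota 0 N) = (s < N).
Proof. by rewrite mem_iota. Qed.

(** With [eq_viol] this makes violations local to the interval of node numbers of [phi], so families
    for disjoint subformulas can be glued without interference. *)
Lemma viol_node sg x m (phi : formula sg) q L j s :
  viol x m phi q L j s -> q <= j < q + nodes phi.
Proof.
elim: phi q => [R ts|R ts|u w|u w|k us ws|p IHp r IHr|p IHp r IHr|v p IHp|v p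
  IHp] q /=;
  try by case/andP=> /eqP-> _; rewrite leqnn addn1 ltnSn.
- have [p_gt0 r_gt0] := (nodes_gt0 p, nodes_gt0 r).
  by case/or4P=> [/andP[/eqP-> _]|/andP[/orP[]/eqP-> _]|/IHp|/IHr]; lia.
- have [p_gt0 r_gt0] := (nodes_gt0 p, nodes_gt0 r).
  by case/or4P=> [/andP[/eqP-> _]|/andP[/orP[]/eqP-> _]|/IHp|/IHr]; lia.
- have p_gt0 := nodes_gt0 p.
  by case/or3P=> [/andP[/eqP-> _]|/andP[/eqP-> _]|/IHp]; lia.
- have p_gt0 := nodes_gt0 p.
  by case/or3P=> [/andP[/eqP-> _]|/andP[/eqP-> _]|/IHp]; lia.
Qed.

Lemma eq_viol sg x m (phi : formula sg) q L L' j s :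
  (forall j' s', q <= j' < q + nodes phi -> s' < dom_size x ^ m ->
    L j' s' = L' j' s') ->
  s < dom_size x ^ m -> viol x m phi q L j s = viol x m phi q L' j s.
Proof.
elim: phi q => [R ts|R ts|u w|u w|k us ws|p IHp r IHr|p IHp r IHr|v p IHp|v p
  IHp] q hL hs //=.
- congr (_ && ~~ _); apply: eq_in_has => s'; rewrite mem_iota0 => hs' /=.
  by rewrite hL //=; lia.
- have [p_gt0 r_gt0] := (nodes_gt0 p, nodes_gt0 r); rewrite /= in hL.
  rewrite (IHp q.+1) // ?(IHr (q.+1 + nodes p)) // ?hL //; try lia;
    by move=> j' s' hj; apply: hL; lia.
- have [p_gt0 r_gt0] := (nodes_gt0 p, nodes_gt0 r); rewrite /= in hL.
  rewrite (IHp q.+1) // ?(IHr (q.+1 + nodes p)) // ?hL //; try lia;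
    by move=> j' s' hj; apply: hL; lia.
- have p_gt0 := nodes_gt0 p; rewrite /= in hL.
  rewrite (IHp q.+1) //; last by move=> j' s' hj; apply: hL; lia.
  congr [|| _ && ~~ _, _ && ~~ _ | _]; apply: eq_in_has => s';
    rewrite mem_iota0 => hs' /=;
    rewrite hL //; lia.
- have p_gt0 := nodes_gt0 p; rewrite /= in hL.
  rewrite (IHp q.+1) //; last by move=> j' s' hj; apply: hL; lia.
  congr [|| _ && _, _ && ~~ _ | _]; apply: eq_in_has => s';
    rewrite mem_iota0 => hs' /=;
    rewrite hL //; lia.
Qed.

(** Each clause demands other memberships and never forbids one, since negation stays in first-order
    literals; shrinking a family can only break more demands. This monotonicity yields the greatest
    consistent family. *)
Lemma viol_mono sg x m (phi : formula sg) q (L L' : nat -> nat -> bool) j s :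
  (forall j' s', L' j' s' -> L j' s') ->
  viol x m phi q L j s -> viol x m phi q L' j s.
Proof.
move=> hL; have hN j' s' : ~~ L j' s' -> ~~ L' j' s' by apply: contra; apply: hL.
have mono_has (P P' : pred nat) r : (forall i, P' i -> P i) -> ~~ has P r ->
  ~~ has P' r.
  by move=> hP; apply: contra; apply: sub_has.
elim: phi q => [R ts|R ts|u w|u w|k us ws|p IHp r IHr|p IHp r IHr|v p IHp|v p
  IHp] q //=.
- case/andP=> -> /=; apply: mono_has => s' /andP[/hL-> ->] //.
- case/or4P=> [/andP[-> h]|/andP[-> /hN->]|/IHp->|/IHr->]; rewrite ?orbT //=.
  by apply/orP; left; apply: contra h => /andP[/hL-> /hL->].
- case/or4P=> [/andP[-> h]|/andP[-> /hN->]|/IHp->|/IHr->]; rewrite ?orbT //=.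
  by apply/orP; left; apply: contra h => /orP[]/hL->; rewrite ?orbT.
- case/or3P=> [/andP[-> h]|/andP[-> h]|/IHp->]; rewrite ?orbT //=.
    by apply/orP; left; apply: mono_has h => s' /andP[-> /hL->].
  by apply/orP; right; apply/orP; left; apply: mono_has h => s' /andP[-> /hL->].
- case/or3P=> [/andP[-> h]|/andP[-> h]|/IHp->]; rewrite ?orbT //=.
    by apply/orP; left; apply: sub_has h => s' /andP[-> /hN->].
  by apply/orP; right; apply/orP; left; apply: mono_has h => s' /andP[-> /hL->].
Qed.

Fixpoint quantified_below sg (m : nat) (phi : formula sg) : bool :=
  match phi with
  | And p r | Or p r => quantified_below m p && quantified_below m r
  | Ex v p | All v p => (v < m) && quantified_below m p
  | _ => true
  end.

Section Labelling.
Variables (sg : signature) (A : structure sg) (m : nat).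
Local Notation n := #|A|.
Local Notation N := (#|A| ^ m).
Local Notation x := (encode A).
Local Open Scope fset_scope.

Definition restrict (X : {fset nat}) (s : nat) : assignment A :=
  [fmap v : X => elt A (digit n s (val v))]%fmap.

(** Codes that differ only outside [X] collapse to one assignment, so [U] is in general not
    determined by this team. *)
Definition img (X : {fset nat}) (U : pred nat) : team A :=
  [fset restrict X s | s in [seq s <- iota 0 N | U s]].

Definition consistent (phi : formula sg) (q : nat) (L : nat -> nat ->
  bool) : Prop :=
  forall j s, s < N -> L j s -> ~~ viol x m phi q L j s.

Lemma restrict_get X s v : v \in X ->
  (restrict X s).[? v]%fmap = Some (elt A (digit n s v)).
Proof. by move=> hv; rewrite in_fnd ffunE. Qed.

Lemma imgP X (U : pred nat) g :
  reflect (exists s, [/\ s < N, U s & g = restrict X s]) (g \in img X U).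
Proof.
apply: (iffP (imfsetP _ _ _ _)) => [[s /=]|[s [hs us ->]]].
  by rewrite mem_filter mem_iota0 => /andP[us hs] ->; exists s.
by exists s => //=; rewrite mem_filter mem_iota0 us.
Qed.

Lemma restrict_set X v s s' : {in X, forall y, y < m} -> agree_off n m v s s' ->
  (restrict X s).[v <- elt A (digit n s' v)]%fmap = restrict (v |` X) s'.
Proof.
move=> hX /allP hss'; apply/fmapP => y; rewrite fnd_set.
have [->|ne_yv] := eqVneq y v; first by rewrite restrict_get // fset1U1.
case yX: (y \in X).
  rewrite !restrict_get ?inE ?yX ?orbT //.
  have := hss' y; rewrite mem_iota0 (negbTE ne_yv) /= => /(_ (hX y yX))/eqP.
  by rewrite /digit => ->.
by rewrite !not_fnd //= ?inE ?yX ?(negbTE ne_yv).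
Qed.

(** Only the digit at [v] is replaced, by the number of [a]; it exists as a digit because
    [v < m]. *)
Lemma exists_agree_off v s (a : A) : v < m ->
  exists s', [/\ s' < N, agree_off n m v s s' & elt A (digit n s' v) = a].
Proof.
move=> lt_v; have [i lt_i <-] := eltK a.
pose c (y : 'I_m) := if y == v :> nat then i else digit n s y.
have hc y : c y < n by rewrite /c; case: ifP => // _; apply: digit_lt (dom_gt0 A).
exists (of_digits n c); split; first exact: of_digits_lt.
  apply/allP => y; rewrite mem_iota0 => hy.
  by have := digit_of_digits (Ordinal hy) hc; rewrite /c /=; case: eqP => //= _ ->.
by have := digit_of_digits (Ordinal lt_v) hc; rewrite /c /= eqxx => ->.
Qed.

Lemma get_restrict X s (Y : {fset nat}) v : Y `<=` X -> v \in Y ->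
  (restrict X s).[? v]%fmap = Some (elt A (digit n s v)).
Proof. by move=> /fsubsetP hY /hY; apply: restrict_get. Qed.

Lemma tcode_restrict X s (t : term sg) : term_vars t `<=` X ->
  tcode x s t < n /\ eval (restrict X s) t = elt A (tcode x s t).
Proof. by move=> hX; apply: tcode_eval => v; apply: get_restrict. Qed.

Lemma rel_bit_restrict X s R (ts : 'I_(rel_ar R) -> term sg) :
  \big[fsetU/fset0]_i term_vars (ts i) `<=` X ->
  rel_bit x s ts = rel_int (R := R) [ffun i => eval (restrict X s) (ts i)].
Proof.
move=> hX; apply: rel_bit_eval => i v; apply: get_restrict.
apply: fsubset_trans hX.
exact: (bigfcup_sup (fun i => term_vars (ts i)) (mem_index_enum i)).
Qed.

Lemma eval_eq_tcode X s s' (t u : term sg) : term_vars t `<=` X ->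
  term_vars u `<=` X ->
  (eval (restrict X s) t == eval (restrict X s') u) = (tcode x s t == tcode x s' u).
Proof.
move=> /(tcode_restrict s)[lt_t ->] /(tcode_restrict s')[lt_u ->].
exact: elt_inj.
Qed.

(** The downward clauses give one inclusion and the upward clauses the other, so the image of each
    child is exactly the team that the semantics prescribes. The domain [X] is arbitrary above
    [Fr phi], as it grows by [v] under a quantifier. *)
Lemma consistent_sat (phi : formula sg) q L X : quantified_below m phi ->
  {in X, forall v, v < m} -> Fr phi `<=` X -> consistent phi q L ->
  sat (img X (L q)) phi.
Proof.
have sub_consistent (psi p : formula sg) k k' :
    (forall j s, viol x m p k' L j s -> viol x m psi k L j s) ->
    consistent psi k L -> consistent p k' L.
  by move=> h hc j s hs /(hc j s hs); apply: contra; apply: h.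
have img_eq (Y : {fset nat}) (U U' : pred nat) :
    (forall s, s < N -> U s = U' s) -> img Y U = img Y U'.
  by move=> hU; apply/fsetP => g; apply/imgP/imgP => -[s [hs us ->]]; exists s;
    rewrite ?hU // -?hU.
elim: phi q X => [R ts|R ts|t u|t u|k us ws|p IHp r IHr|p IHp r IHr|v p IHp|v p IHp]
  q X /= hq hX hF hc.
- move=> g /imgP[s [hs us ->]]; rewrite -rel_bit_restrict //.
  by have := hc q s hs us; rewrite /= eqxx negbK.
- move=> g /imgP[s [hs us ->]]; rewrite -rel_bit_restrict //.
  by have := hc q s hs us; rewrite /= eqxx.
- move=> g /imgP[s [hs us ->]]; move: hF; rewrite fsubUset => /andP[ht hu].
  by have := hc q s hs us; rewrite /= eqxx negbK -(eval_eq_tcode s s ht hu) => /eqP.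
- move=> g /imgP[s [hs us ->]]; move: hF; rewrite fsubUset => /andP[ht hu].
  by have := hc q s hs us; rewrite /= eqxx -(eval_eq_tcode s s ht hu) => /eqP.
- move=> g /imgP[s [hs Ls ->]]; have := hc q s hs Ls.
  rewrite /= eqxx negbK dom_size_encode => /hasP[s'];
    rewrite mem_iota0 => hs' /andP[Ls' /allP h].
  exists (restrict X s'); first by apply/imgP; exists s'.
  move=> i; have : term_vars (us i) `|` term_vars (ws i) `<=` X.
    apply: fsubset_trans hF.
    exact: (bigfcup_sup (fun i => term_vars (us i) `|` term_vars (ws i))
      (mem_index_enum i)).
  rewrite fsubUset => /andP[hu hw]; apply/eqP.
  by rewrite eval_eq_tcode // h ?mem_enum.
- have [hp hr] := andP hq; move: hF; rewrite fsubUset => /andP[hFp hFr].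
  have L_q s : s < N -> L q s = L q.+1 s /\ L q s = L (q.+1 + nodes p)%N s.
    move=> hs; have h1 : L q s -> L q.+1 s && L (q.+1 + nodes p)%N s.
      by move=> /(hc q s hs); rewrite /= eqxx => /norP[]; rewrite negbK.
    have h2 : L q.+1 s -> L q s.
      by move=> /(hc _ s hs); rewrite /= eqxx => /norP[_ /norP[]]; rewrite negbK.
    have h3 : L (q.+1 + nodes p)%N s -> L q s.
      by move=> /(hc _ s hs); rewrite /= eqxx orbT => /norP[_ /norP[]];
        rewrite negbK.
    by split; apply/idP/idP => // /h1/andP[].
  split.
    rewrite (img_eq X _ (L q.+1)) => [|s hs]; last exact: (L_q s hs).1.
    by apply: IHp => //; apply: sub_consistent hc => j s /= ->; rewrite !orbT.
  rewrite (img_eq X _ (L (q.+1 + nodes p)%N)) => [|s hs]; last exact: (L_q s hs).2.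
  by apply: IHr => //; apply: sub_consistent hc => j s /= ->; rewrite !orbT.
- have [hp hr] := andP hq; move: hF; rewrite fsubUset => /andP[hFp hFr].
  have L_q s : s < N -> L q s = L q.+1 s || L (q.+1 + nodes p)%N s.
    move=> hs; have h1 : L q s -> L q.+1 s || L (q.+1 + nodes p)%N s.
      by move=> /(hc q s hs); rewrite /= eqxx => /norP[]; rewrite negbK.
    have h2 : L q.+1 s -> L q s.
      by move=> /(hc _ s hs); rewrite /= eqxx => /norP[_ /norP[]]; rewrite negbK.
    have h3 : L (q.+1 + nodes p)%N s -> L q s.
      by move=> /(hc _ s hs); rewrite /= eqxx orbT => /norP[_ /norP[]];
        rewrite negbK.
    by apply/idP/orP => [/h1/orP //|[/h2|/h3]].
  exists (img X (L q.+1)), (img X (L (q.+1 + nodes p)%N)); split.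
  + apply/fsetP => g; rewrite inE; apply/imgP/orP.
      case=> s [hs]; rewrite L_q // => /orP[us|us] ->; [left|right];
        by apply/imgP; exists s.
    by case=> /imgP[s [hs us ->]]; exists s; rewrite L_q // us ?orbT.
  + by apply: IHp => //; apply: sub_consistent hc => j s /= ->; rewrite !orbT.
  + by apply: IHr => //; apply: sub_consistent hc => j s /= ->; rewrite !orbT.
- have [hv hp] := andP hq.
  have down s : s < N -> L q s ->
      exists s', [/\ s' < N, agree_off n m v s s' & L q.+1 s'].
    move=> hs Ls; have := hc q s hs Ls; rewrite /= eqxx dom_size_encode /=.
    case/norP; rewrite negbK => /hasP[s']; rewrite mem_iota0 => hs' /andP[] *.
    by exists s'.
  have up s' : s' < N -> L q.+1 s' ->
      exists s, [/\ s < N, agree_off n m v s s' & L q s].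
    move=> hs Ls; have := hc q.+1 s' hs Ls; rewrite /= eqxx dom_size_encode /=.
    case/norP=> _ /norP[]; rewrite negbK => /hasP[s];
      rewrite mem_iota0 => ? /andP[h ?] _.
    by exists s; rewrite agree_off_sym.
  (* Several codes may restrict to [g]; the choice function collects the values of [v] that the
     child team offers to any of them. *)
  exists (fun g => [set a | has (fun s => [&& L q s, restrict X s == g &
    has (fun s' => [&& agree_off n m v s s', L q.+1 s' & elt A (digit n s' v) == a])
      (iota 0 N)]) (iota 0 N)]).
    move=> g /imgP[s [hs Ls ->]]; have [s' [hs' ss' Ls']] := down s hs Ls.
    apply/set0Pn; exists (elt A (digit n s' v)); rewrite inE.
    apply/hasP; exists s; rewrite ?mem_iota0 // Ls eqxx /=.
    by apply/hasP; exists s'; rewrite ?mem_iota0 // ss' Ls' eqxx.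
  set T := [fset _ | _ in _, _ in _]; suff -> : T = img (v |` X) (L q.+1).
    apply: IHp => //; first by move=> y; rewrite !inE => /orP[/eqP->|/hX].
      by rewrite -fsubDset.
    by apply: sub_consistent hc => j s /= ->; rewrite !orbT.
  apply/fsetP => g; apply/imfset2P/imgP => [[h _ [a /=]]|[s' [hs' Ls' ->]]].
    rewrite inE => /hasP[s _ /and3P[_ /eqP<- /hasP[s' hs' /and3P[ss' Ls'
      /eqP<-]]]] ->.
    by exists s'; rewrite -mem_iota0 restrict_set.
  have [s [hs ss' Ls]] := up s' hs' Ls'.
  exists (restrict X s); first by apply/imgP; exists s.
  exists (elt A (digit n s' v)); last by rewrite restrict_set.
  rewrite inE; apply/hasP; exists s; rewrite ?mem_iota0 // Ls eqxx /=.
  by apply/hasP; exists s'; rewrite ?mem_iota0 // ss' Ls' eqxx.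
- have [hv hp] := andP hq.
  have down s s' : s < N -> L q s -> s' < N -> agree_off n m v s s' -> L q.+1 s'.
    move=> hs Ls hs' ss'; have := hc q s hs Ls; rewrite /= eqxx dom_size_encode /=.
    case/norP=> /hasPn/(_ s'); rewrite mem_iota0 => /(_ hs'); rewrite ss' /= negbK.
    by move=> ->.
  have up s' : s' < N -> L q.+1 s' ->
      exists s, [/\ s < N, agree_off n m v s s' & L q s].
    move=> hs Ls; have := hc q.+1 s' hs Ls; rewrite /= eqxx dom_size_encode /=.
    case/norP=> _ /norP[]; rewrite negbK => /hasP[s];
      rewrite mem_iota0 => ? /andP[h ?] _.
    by exists s; rewrite agree_off_sym.
  set T := [fset _ | _ in _, _ in _]; suff -> : T = img (v |` X) (L q.+1).
    apply: IHp => //; first by move=> y; rewrite !inE => /orP[/eqP->|/hX].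
      by rewrite -fsubDset.
    by apply: sub_consistent hc => j s /= ->; rewrite !orbT.
  apply/fsetP => g; apply/imfset2P/imgP => [[h /imgP[s [hs Ls ->]] [a _ ->]]|].
    have [s' [hs' ss' <-]] := exists_agree_off s a hv.
    by exists s'; rewrite restrict_set //; split=> //; apply: down ss'.
  case=> s' [hs' Ls' ->]; have [s [hs ss' Ls]] := up s' hs' Ls'.
  exists (restrict X s); first by apply/imgP; exists s.
  by exists (elt A (digit n s' v)); rewrite ?inE ?restrict_set.
Qed.

(** The set of codes at the root is prescribed, not just its image: the families of the children are
    requested for specific sets of codes, chosen to meet the clauses of their parent. *)
Lemma sat_consistent (phi : formula sg) q X (U : pred nat) :
  quantified_below m phi -> {in X, forall v, v < m} -> Fr phi `<=` X ->
  sat (img X U) phi -> exists2 L, L q = U & consistent phi q L.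
Proof.
have in_img (Y : {fset nat}) (U' : pred nat) s : s < N -> U' s ->
  restrict Y s \in img Y U'.
  by move=> hs us; apply/imgP; exists s.
have literal (psi : formula sg) k (U' : pred nat) :
    (forall s, s < N -> U' s -> ~~ viol x m psi k (fun=> U') k s) ->
    (forall j s, viol x m psi k (fun=> U') j s -> j = k) ->
    exists2 L, L k = U' & consistent psi k L.
  move=> h hk; exists (fun=> U') => // j s hs us; apply/negP => hv.
  by move: (hv); rewrite (hk _ _ hv) (negbTE (h s hs us)).
(* Prescribing the team of the new root does not disturb the nodes below it, whose numbers are
   larger; [glue2] does the same for two children with disjoint intervals. *)
have glue1 (p : formula sg) k (U' : pred nat) L1 : consistent p k.+1 L1 ->
    let L j := if j == k then U' else L1 j in
    forall j s, s < N -> L j s -> ~~ viol x m p k.+1 L j s.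
  move=> hc L j s hs Ls; apply/negP => hv; have hj := viol_node hv.
  have jk : j == k = false by lia.
  rewrite /L jk in Ls; have /negP[] := hc j s hs Ls.
  rewrite -(@eq_viol _ _ _ _ _ L) // ?dom_size_encode // => j' s' hj' _.
  by rewrite /L ifF //; lia.
have glue2 (p r : formula sg) k k' (U' : pred nat) L1 L2 :
    k' = (k.+1 + nodes p)%N -> consistent p k.+1 L1 -> consistent r k' L2 ->
    let L j := if j == k then U' else if j < k' then L1 j else L2 j in
    forall j s, s < N -> L j s -> viol x m p k.+1 L j s || viol x m r k' L j s
      = false.
  move=> ek c1 c2 L j s hs Ls; apply/negP => /orP[] hv; have hj := viol_node hv.
    have [jk jk'] : j == k = false /\ j < k' by split; lia.
    rewrite /L jk jk' in Ls; have /negP[] := c1 j s hs Ls.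
    rewrite -(@eq_viol _ _ _ _ _ L) // ?dom_size_encode // => j' s' hj' _.
    by rewrite /L ifF ?ifT //; lia.
  have [jk jk'] : j == k = false /\ j < k' = false by split; lia.
  rewrite /L jk jk' in Ls; have /negP[] := c2 j s hs Ls.
  rewrite -(@eq_viol _ _ _ _ _ L) // ?dom_size_encode // => j' s' hj' _.
  by rewrite /L !ifF //; lia.
elim: phi q X U => [R ts|R ts|t u|t u|k us ws|p IHp r IHr|p IHp r IHr|v p IHp|v
  p IHp]
  q X U /= hq hX hF hsat.
- apply: literal => [s hs us|j s /= /andP[/eqP->]] //=.
  by rewrite eqxx negbK (rel_bit_restrict s hF) hsat ?in_img.
- apply: literal => [s hs us|j s /= /andP[/eqP->]] //=.
  by rewrite eqxx (rel_bit_restrict s hF) hsat ?in_img.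
- move: hF; rewrite fsubUset => /andP[ht hu].
  apply: literal => [s hs us|j s /= /andP[/eqP->]] //=.
  by rewrite eqxx negbK -(eval_eq_tcode s s ht hu) hsat ?in_img.
- move: hF; rewrite fsubUset => /andP[ht hu].
  apply: literal => [s hs us|j s /= /andP[/eqP->]] //=.
  by rewrite eqxx -(eval_eq_tcode s s ht hu); apply/eqP/hsat/in_img.
- apply: literal => [s hs Us|j s /= /andP[/eqP->]] //=;
    rewrite eqxx negbK dom_size_encode.
  have [g /imgP[s' [hs' Us' ->]] h] := hsat _ (in_img X U s hs Us).
  apply/hasP; exists s'; rewrite ?mem_iota0 // Us' /=; apply/allP => i _.
  have : term_vars (us i) `|` term_vars (ws i) `<=` X.
    apply: fsubset_trans hF.
    exact: (bigfcup_sup (fun i => term_vars (us i) `|` term_vars (ws i))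
      (mem_index_enum i)).
  by rewrite fsubUset => /andP[hu hw]; rewrite -(eval_eq_tcode _ _ hu hw) h.
- have [hp hr] := andP hq; move: hF; rewrite fsubUset => /andP[hFp hFr].
  have [sat_p sat_r] := hsat.
  have [L1 L1U c1] := IHp q.+1 X U hp hX hFp sat_p.
  have [q' eq'] : exists q', q' = (q.+1 + nodes p)%N by exists (q.+1 + nodes p)%N.
  have [L2 L2U c2] := IHr q' X U hr hX hFr sat_r.
  have [nq1 nq' q1q'] : [/\ q.+1 == q = false, q' == q = false & q.+1 < q'].
    by have := nodes_gt0 p; split; lia.
  exists (fun j => if j == q then U else if j < q' then L1 j else L2 j).
    by rewrite eqxx.
  move=> j s hs Ls; rewrite /= -eq' (glue2 _ _ _ _ _ _ _ eq' c1 c2 _ _ hs Ls) orbF.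
  rewrite eqxx nq1 nq' q1q' ltnn L1U L2U.
  move: Ls; case: (eqVneq j q) => [-> Us|_];
    first by rewrite Us [q == _]eq_sym nq1 [q == _]eq_sym nq'.
  case: (eqVneq j q.+1) => [->|_] /=; first by rewrite q1q' L1U => ->.
  by case: (eqVneq j q') => [->|//]; rewrite ltnn L2U => ->.
- have [hp hr] := andP hq; move: hF; rewrite fsubUset => /andP[hFp hFr].
  have [T0 [T1 [hT sat_p sat_r]]] := hsat.
  (* A semantic split is lifted to codes by selecting those in [U] whose restriction falls into the
     given part. *)
  have part (T' : team A) : T' `<=` img X U ->
      img X (fun s => U s && (restrict X s \in T')) = T'.
    move=> /fsubsetP hT'; apply/fsetP => g;
      apply/imgP/idP => [[s [_ /andP[_ h] ->]] //|hg].
    by have /imgP[s [hs Us eg]] := hT' g hg; exists s; rewrite Us -eg hg.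
  rewrite -(part T0) in sat_p; last by rewrite hT fsubsetUl.
  rewrite -(part T1) in sat_r; last by rewrite hT fsubsetUr.
  have [L1 L1U c1] := IHp q.+1 X _ hp hX hFp sat_p.
  have [q' eq'] : exists q', q' = (q.+1 + nodes p)%N by exists (q.+1 + nodes p)%N.
  have [L2 L2U c2] := IHr q' X _ hr hX hFr sat_r.
  have [nq1 nq' q1q'] : [/\ q.+1 == q = false, q' == q = false & q.+1 < q'].
    by have := nodes_gt0 p; split; lia.
  exists (fun j => if j == q then U else if j < q' then L1 j else L2 j).
    by rewrite eqxx.
  move=> j s hs Ls; rewrite /= -eq' (glue2 _ _ _ _ _ _ _ eq' c1 c2 _ _ hs Ls) orbF.
  rewrite eqxx nq1 nq' q1q' ltnn L1U L2U.
  move: Ls; case: (eqVneq j q) => [-> Us|_].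
    rewrite Us [q == _]eq_sym nq1 [q == _]eq_sym nq' /= orbF negbK.
    by have := in_img X U s hs Us; rewrite hT inE.
  case: (eqVneq j q.+1) => [->|_] /=; first by rewrite q1q' L1U => /andP[->].
  by case: (eqVneq j q') => [->|//]; rewrite ltnn L2U => /andP[->].
- have [hv hp] := andP hq; have [f f_ne hT] := hsat.
  (* The codes obtained from a member of [U] by changing [v] to a value that the choice function
     allows. *)
  pose U' s' := has (fun s => [&& agree_off n m v s s', U s &
    elt A (digit n s' v) \in f (restrict X s)]) (iota 0 N).
  have [||//|L1 L1U c1] := IHp q.+1 (v |` X) U' hp.
  + by move=> y; rewrite !inE => /orP[/eqP->|/hX].
  + by rewrite -fsubDset.
  + set T := [fset _ | _ in _, _ in _] in hT; suff <- : T = img (v |` X) U' by [].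
    apply/fsetP => g; apply/imfset2P/imgP =>
      [[h /imgP[s [hs Us ->]] [a /= fa ->]]|].
      have [s' [hs' ss' ea]] := exists_agree_off s a hv.
      exists s'; rewrite -ea restrict_set //; split=> //.
      by apply/hasP; exists s; rewrite ?mem_iota0 // ss' Us ea.
    case=> s' [hs' /hasP[s]]; rewrite mem_iota0 => hs /and3P[ss' Us fs'] ->.
    exists (restrict X s); first exact: in_img.
    by exists (elt A (digit n s' v)); rewrite ?restrict_set.
  exists (fun j => if j == q then U else L1 j); first by rewrite eqxx.
  move=> j s hs Ls; rewrite /= (negbTE (glue1 _ _ _ _ c1 _ _ hs Ls)) orbF.
  rewrite eqxx (gtn_eqF (ltnSn q)) L1U dom_size_encode.
  apply/norP; split; apply/negP => /andP[/eqP ej] /hasP[]; subst j.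
    rewrite eqxx in Ls; have /set0Pn[a fa] := f_ne _ (in_img X U s hs Ls).
    have [s' [hs' ss' ea]] := exists_agree_off s a hv.
    exists s'; rewrite ?mem_iota0 // ss'; apply/hasP; exists s;
      rewrite ?mem_iota0 //.
    by rewrite ss' Ls ea.
  move: Ls; rewrite gtn_eqF // L1U => /hasP[s'];
    rewrite mem_iota0 => hs' /and3P[ss' Us' _].
  by exists s'; rewrite ?mem_iota0 // agree_off_sym ss'.
- have [hv hp] := andP hq.
  pose U' s' := has (fun s => agree_off n m v s s' && U s) (iota 0 N).
  have [||//|L1 L1U c1] := IHp q.+1 (v |` X) U' hp.
  + by move=> y; rewrite !inE => /orP[/eqP->|/hX].
  + by rewrite -fsubDset.
  + set T := [fset _ | _ in _, _ in _] in hsat; suff <- : T = img (v |` X) U' by [].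
    apply/fsetP => g; apply/imfset2P/imgP =>
      [[h /imgP[s [hs Us ->]] [a /= fa ->]]|].
      have [s' [hs' ss' <-]] := exists_agree_off s a hv.
      exists s'; rewrite restrict_set //; split=> //.
      by apply/hasP; exists s; rewrite ?mem_iota0 // ss'.
    case=> s' [hs' /hasP[s]]; rewrite mem_iota0 => hs /andP[ss' Us] ->.
    exists (restrict X s); first exact: in_img.
    by exists (elt A (digit n s' v)); rewrite ?inE ?restrict_set.
  exists (fun j => if j == q then U else L1 j); first by rewrite eqxx.
  move=> j s hs Ls; rewrite /= (negbTE (glue1 _ _ _ _ c1 _ _ hs Ls)) orbF.
  rewrite eqxx (gtn_eqF (ltnSn q)) L1U dom_size_encode.
  apply/norP; split; apply/negP => /andP[/eqP ej]; subst j.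
    rewrite eqxx in Ls; case/hasP=> s' _ /andP[ss'] /hasP[].
    by exists s; rewrite ?mem_iota0 // ss'.
  case/hasP; move: Ls; rewrite gtn_eqF // L1U => /hasP[s'];
    rewrite mem_iota0 => hs' /andP[ss' Us'].
  by exists s'; rewrite ?mem_iota0 // agree_off_sym ss'.
Qed.

End Labelling.

(** * Greatest consistent families *)

Section Pass.
Variable V : (nat -> bool) -> nat -> bool.
Hypothesis V_mono : forall c c' : nat -> bool,
  (forall a, c a -> c' a) -> forall a, V c a -> V c' a.

Definition closed (k : nat) (c : nat -> bool) : Prop :=
  forall a, a < k -> V c a -> c a.

(** Minimality: passes only mark what every closed superset must contain. For marks read as
    deletions, a closed set is the complement of a consistent family. *)
Lemma pass_sub_closed T k (c d : nat -> bool) : k <= T -> closed T d ->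
  (forall a, c a -> d a) -> forall a, pass V k c a -> d a.
Proof.
move=> + d_closed; elim: k c => [//|k IH] c lt_k cd /=; apply: IH => [|a];
  first exact: ltnW.
case: eqP => [->|_ /cd //] /orP[/cd //|/(V_mono cd)]; exact: d_closed.
Qed.

Lemma pass_incr k (c : nat -> bool) a : c a -> pass V k c a.
Proof.
elim: k c => [//|k IH] c ca /=; apply: IH.
by case: eqP => // <-; rewrite ca.
Qed.

Lemma pass_ge k (c : nat -> bool) a : k <= a -> pass V k c a = c a.
Proof.
elim: k c => [//|k IH] c lt_ka /=; rewrite IH ?gtn_eqF //; exact: ltnW.
Qed.

(** Marks only accumulate, so if the outcome of a pass adds nothing, every intermediate state agrees
    with [c]; hence all tests were in effect made on [c], although the updates are in place. *)
Lemma pass_stable k (c : nat -> bool) : (forall a, pass V k c a -> c a) ->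
  closed k c.
Proof.
elim: k c => [|k IH] c //=; set c1 := fun a => _ => h a.
have c_c1 b : c b -> c1 b by rewrite /c1; case: eqP => // <- ->.
have c1_c b : c1 b -> c b by move=> /(pass_incr k)/h.
rewrite ltnS leq_eqVlt => /orP[/eqP-> hV|lt_a hV].
  by apply: c1_c; rewrite /c1 eqxx hV orbT.
by apply/c1_c/(IH c1) => // [b /h/c_c1|]; last exact: V_mono hV.
Qed.

Definition count_true (T : nat) (c : nat -> bool) : nat := \sum_(a < T) c a.

Lemma pass_count T (c : nat -> bool) : closed T c \/ count_true T c <
  count_true T (pass V T c).
Proof.
have le_c (a : 'I_T) : (c a <= pass V T c a)%N by case ca: (c a) => //;
  rewrite pass_incr.
case: (boolP [exists a : 'I_T, pass V T c a && ~~ c a]).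
  case/existsP=> a /andP[pa na]; right; rewrite /count_true.
  rewrite (bigD1 a) //= [ltnRHS](bigD1 a) //= pa (negbTE na) add0n add1n ltnS.
  by apply: leq_sum => b _; apply: le_c.
move/existsPn=> stable; left; apply: pass_stable => a.
case: (ltnP a T) => [lt_a pa|le_a]; last by rewrite pass_ge.
by have := stable (Ordinal lt_a); rewrite /= pa negbK.
Qed.

(** Each pass that starts from a state not yet closed marks a new cell, and there are [T] cells;
    closedness, once reached, persists. *)
Lemma iter_pass_closed T (c : nat -> bool) : closed T (iter T (pass V T) c).
Proof.
have closed_pass d : closed T d -> closed T (pass V T d).
  move=> hd; have sub := pass_sub_closed (leqnn T) hd (fun a h => h).
  by move=> a lt_a /(V_mono sub)/(hd a lt_a); apply: pass_incr.
have h k : closed T (iter k (pass V T) c) \/ k <= count_true T (iter k (pass V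
  T) c).
  elim: k => [|k [hk|hk]] /=; [by right|by left; apply: closed_pass|].
  by case: (pass_count T (iter k (pass V T) c)) =>
    [/closed_pass|/(leq_ltn_trans hk)]; [left|right].
(* In the remaining case all [T] cells are marked, and closedness is trivial. *)
case: (h T) => //; set d := iter T _ _ => full a lt_a _.
apply: contraLR full => na; rewrite -ltnNge /count_true.
rewrite (bigD1 (Ordinal lt_a)) //= (negbTE na) add0n.
apply: leq_ltn_trans (_ : \sum_(i < T | i != Ordinal lt_a) 1 < T).
  by apply: leq_sum => i _; case: (d i).
rewrite sum1_card; have := cardC1 (Ordinal lt_a); rewrite card_ord => ->.
by rewrite ltn_predL; apply: leq_ltn_trans lt_a.
Qed.

End Pass.

(** * The decision procedure and its correctness *)

Fixpoint var_bound sg (phi : formula sg) : nat :=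
  match phi with
  | And p r | Or p r => maxn (var_bound p) (var_bound r)
  | Ex v p | All v p => maxn v.+1 (var_bound p)
  | _ => 0
  end.

Lemma quantified_below_bound sg (phi : formula sg) m :
  var_bound phi <= m -> quantified_below m phi.
Proof.
elim: phi => //= [p IHp r IHr|p IHp r IHr|v p IHp|v p IHp];
  rewrite geq_max => /andP[h1 h2].
- by rewrite IHp ?IHr.
- by rewrite IHp ?IHr.
- by rewrite h1 IHp.
- by rewrite h1 IHp.
Qed.

Section Decision.
Variables (sg : signature) (phi : formula sg).
Let m := var_bound phi.
Local Notation N x := (dom_size x ^ m).

Definition num_cells (t : inp) : nat := nodes phi * N (bits t).

Definition cell_viol (t : inp) (a : nat) : bool :=
  viol (bits t) m phi 0 (team_of m t) (a %/ N (bits t)) (a %% N (bits t)).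

(** The flag is the test [k == 1]. Without it the witness is the empty team, which satisfies every
    sentence, so validity of the input decides. *)
Definition accept (t : inp) : bool :=
  valid sg (bits t) && (~~ flag t || has (team_of m t 0) (iota 0 (N (bits t)))).

Lemma cell_viol_mono t (c c' : nat -> bool) : (forall a, c a -> c' a) ->
  forall a, cell_viol (set_cells t c) a -> cell_viol (set_cells t c') a.
Proof.
move=> hc a; apply: viol_mono => j s; rewrite /team_of /=.
by apply: contra; apply: hc.
Qed.

Lemma polytime_num_cells : polytime (num_cells : Ctx 0 -> nat).
Proof. exact: polytime_mul (polytime_const _) (polytime_exp _
  (polytime_dom_size 0)). Qed.

Lemma polytime_cell_viol : polytime (fun t : Ctx 1 => cell_viol t.1 t.2).
Proof.
have hN := polytime_exp m (polytime_dom_size 1).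
by apply: (@polytime_viol sg 1); [apply: polytime_div | apply: polytime_mod] => //;
  apply: polytime_last.
Qed.

Lemma polytime_accept : polytime (fun t : Ctx 0 => accept t).
Proof.
apply: polytime_and; first exact: (polytime_valid sg 0).
apply: polytime_or; first exact: polytime_neg (polytime_flag 0).
apply: (@polytime_has 0 (fun t => N (bits t)) (fun t => team_of m t 0)).
  exact: polytime_exp (polytime_dom_size 0).
exact: (polytime_team_of m 0 (polytime_last 0)).
Qed.

Section Correctness.
Variables (A : structure sg) (b : bool).
Hypothesis phi_sentence : Fr phi = fset0.
Local Notation n := #|A|.
Let t0 := Inp b (encode A) (fun=> false).
Let final := final_cells num_cells cell_viol t0.

Let below : quantified_below m phi.
Proof. exact: quantified_below_bound. Qed.

Let N_gt0 : 0 < n ^ m.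
Proof. by rewrite expn_gt0 dom_gt0. Qed.

Lemma cell_div j s : s < n ^ m ->
  (j * n ^ m + s) %/ n ^ m = j /\ (j * n ^ m + s) %% n ^ m = s.
Proof. by move=> hs; rewrite divnMDl // divn_small // addn0 modnMDl modn_small. Qed.

Lemma consistent_final : consistent A m phi 0 (team_of m final).
Proof.
move=> j s hs; apply: contraL => hv;
  rewrite /team_of negbK [bits _]/= dom_size_encode.
have hj : j < nodes phi by have := viol_node hv; rewrite add0n.
have [ej es] := cell_div j hs.
have violE c : cell_viol (set_cells t0 c) (j * n ^ m + s) =
    viol (encode A) m phi 0 (team_of m (set_cells t0 c)) j s.
  by rewrite /cell_viol /= dom_size_encode ej es.
apply: (iter_pass_closed (V := fun c =>
  cell_viol (set_cells t0 c)) (@cell_viol_mono t0)).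
  rewrite /num_cells /= dom_size_encode.
  by apply: (@leq_trans (j.+1 * n ^ m));
    rewrite ?leq_pmul2r // mulSn addnC ltn_add2r.
by rewrite violE.
Qed.

Lemma consistent_sub_final L j s : consistent A m phi 0 L -> s < n ^ m -> L j s ->
  team_of m final j s.
Proof.
move=> hL hs Ls; rewrite /team_of /= dom_size_encode.
(* The complement of a consistent family is closed under deletion, so it contains every mark that
   the passes set. *)
pose d a := ~~ L (a %/ n ^ m) (a %% n ^ m).
have hd : closed (fun c => cell_viol (set_cells t0 c)) (num_cells t0) d.
  move=> a _; rewrite /cell_viol /= dom_size_encode => hv; apply/negP => La.
  have /negP[] := hL _ _ (ltn_pmod a N_gt0) La.
  rewrite -(eq_viol (L := team_of m (set_cells t0 d))) // ?dom_size_encode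
    ?ltn_pmod //.
  move=> j' s' _ hs'; rewrite /team_of /d /= dom_size_encode negbK.
  by have [-> ->] := cell_div j' hs'.
have sub k a : iter k (pass (fun c => cell_viol (set_cells t0 c)) (num_cells t0))
    (fun=> false) a -> d a.
  elim: k a => [//|k IH] a /=.
  exact: (pass_sub_closed (@cell_viol_mono t0) (leqnn _) hd IH).
apply/negP => /sub; have [ej es] := cell_div j hs.
by rewrite /d ej es Ls.
Qed.

(** Over the empty domain all codes restrict to the empty assignment; only nonemptiness of [U]
    survives. *)
Let img0E (U : pred nat) : (exists2 s, s < n ^ m & U s) ->
  img A m fset0 U = [fset [fmap]%fmap]%fset.
Proof.
have restrict0 s : restrict A fset0 s = [fmap]%fmap.
  by apply/fmapP => y; rewrite !not_fnd.
case=> s hs us; apply/fsetP => g; rewrite inE;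
  apply/imgP/eqP => [[s' [_ _ ->]] //|->].
by exists s; rewrite restrict0.
Qed.

Lemma accept_final : accept final =
  ~~ b || has (team_of m final 0) (iota 0 (n ^ m)).
Proof. by rewrite /accept /= valid_encode dom_size_encode. Qed.

(** The family of empty teams is consistent, because constraints bear on members only. *)
Lemma sat_empty : sat (fset0 : team A) phi.
Proof.
suff <- : img A m fset0 (fun=> false) = fset0.
  apply: (@consistent_sat _ A m phi 0 (fun _ => fun=> false)) => //.
  by rewrite phi_sentence.
by apply/fsetP => g; rewrite inE; apply/imgP => -[s []].
Qed.

Lemma sat_unit_final :
  sat [fset [fmap]%fmap : assignment A]%fset phi <->
  has (team_of m final 0) (iota 0 (n ^ m)).
Proof.
split=> [hsat|/hasP[s]]; last first.
  rewrite mem_iota0 => hs Ls; rewrite -(@img0E (team_of m final 0));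
    last by exists s.
  by apply: (consistent_sat below _ _ consistent_final) => //; rewrite phi_sentence.
(* The unit team is the image of the full set of codes, which [sat_consistent] can then install at
   the root; code 0 lies in it. *)
rewrite -(@img0E (fun=> true)) in hsat; last by exists 0.
have [//||L L0 hL] := sat_consistent 0 below _ _ hsat.
  by rewrite phi_sentence.
apply/hasP; exists 0; rewrite ?mem_iota0 //.
by apply: (consistent_sub_final hL) => //; rewrite L0.
Qed.

End Correctness.
End Decision.

Lemma team_on_fset0 sg (A : structure sg) (T : team A) :
  team_on fset0 T -> T = fset0 \/ T = [fset [fmap]%fmap]%fset.
Proof.
move=> hT; have sub : (T `<=` [fset [fmap]%fmap])%fset.
  apply/fsubsetP => g /hT hg; rewrite inE; apply/eqP/fmapP => y.
  have y_g : y \notin domf g by rewrite hg.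
  by rewrite !not_fnd.
by move: sub; rewrite fsubset1 => /orP[/eqP|/eqP]; [right|left].
Qed.

Theorem theorem10 (sg : signature) (phi : formula sg) (hphi : Fr phi = fset0) :
  FPT (p_WT phi).
Proof.
apply: (@FPT_final_cells _ (num_cells phi) (cell_viol phi) (accept phi)) => //.
- exact: polytime_num_cells.
- exact: polytime_cell_viol.
- exact: polytime_accept.
move=> x k; rewrite /p_WT hphi; split.
  case=> A -> [T [hT hk hsat]]; rewrite accept_final.
  case: (team_on_fset0 hT) => eT; rewrite eT in hk hsat.
    by rewrite -hk cardfs0.
  rewrite -hk cardfs1; split=> //=.
  exact/(@sat_unit_final sg phi _ true hphi).
case=> k_le1 acc; have x_valid : valid sg x by case/andP: acc.
exists (decode x_valid); first exact: encode_decode.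
rewrite (encode_decode x_valid) accept_final in acc.
case: k k_le1 acc => [_ _|[|//] _ /= acc].
  by exists fset0; split=> //; apply: sat_empty.
exists [fset [fmap]%fmap]%fset; split;
  last exact/(@sat_unit_final sg phi _ true hphi).
  by move=> g; rewrite inE => /eqP->.
by rewrite cardfs1.
Qed.
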